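(* Let $\sigma$ be an even-type nilpotent cone with $\dim\operatorname{Im}N\le h^{0,-1}$ for all $N\in\sigma^\circ$. Then the map $p^{\mathrm{ev}}:\mathbf B(\sigma)\to\mathbf B_{\mathrm{tor}}(\sigma)$ is surjective.
   Context: Let $H_{\mathbb Z}$ be a free $\mathbb Z$-module of rank $2n$ with the alternating form $Q$ given in some basis by $\begin{pmatrix}0&I\\-I&0\end{pmatrix}$; $H_A=H_{\mathbb Z}\otimes A$, $G_A=\mathrm{Aut}(H_A,Q)\cong Sp(n,A)$, $\mathfrak g=\mathrm{Lie}(G_{\mathbb R})$. Let $\{h^{p,-p-1}\}_p$ be Hodge numbers of weight $-1$ ($h^{p,-p-1}=h^{-p-1,p}\ge 0$, $\sum_p h^{p,-p-1}=2n$). Let $D$ be the period domain of Hodge structures $F$ of weight $-1$ on $H_{\mathbb Z}$ polarized by $Q$ with these Hodge numbers (so $Q(F^p,F^{-p})=0$ and $i^{p-q}Q(v,\bar v)>0$ for $0\ne v\in H^{p,q}$), and let $\check D$ be its compact dual (flags of the same dimensions with $Q(F^p,F^{-p})=0$). Let $\mathscr H$ be the Siegel space of degree $n$, regarded as the period domain with $h^{0,-1}=h^{-1,0}=n$. All cones are finitely generated convex rational polyhedral cones. A nilpotent cone is $\sigma=\sum_{j=1}^{\ell}\mathbb R_{\ge0}N_j$ with mutually commuting nilpotent $N_j\in\mathfrak g_{\mathbb Q}$; $\sigma^\circ$ is its relative interior, $\sigma_{\mathbb C}$ its complex span. For $F\in\check D$, $(\sigma,\exp(\sigma_{\mathbb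 C})F)$ is a nilpotent orbit (a $\sigma$-nilpotent orbit) if $\exp(\sum_j i x_jN_j)F\in D$ for all $x_j\gg0$ and $NF^p\subset F^{p-1}$ for all $p$ and $N\in\sigma$. Then all $N\in\sigma^\circ$ have the same monodromy weight filtration $W(\sigma)$, centered at weight $-1$, and $(W(\sigma),F)$ is a mixed Hodge structure (the limiting mixed Hodge structure) with Deligne decomposition $H_{\mathbb C}=\bigoplus I^{p,q}$, $W_k=\sum_{p+q\le k}I^{p,q}$, $F^\ell=\sum_{p\ge\ell}I^{p,q}$. The orbit is even-type if $N^2=0$ for all $N\in\sigma$ and $I^{p,-p}=0$ for all odd $p$. The cone $\sigma$ is even-type if it generates at least one nilpotent orbit (for $D$) and all $\sigma$-nilpotent orbits are even-type. $\mathbf B(\sigma)$ (resp. $\mathbf B_{\mathrm{tor}}(\sigma)$) is the set of $\sigma$-nilpotent orbits for $D$ (resp. for $\mathscr H$). For $\sigma$ even-type, $p^{\mathrm{ev}}:\mathbf B(\sigma)\to\mathbf B_{\mathrm{tor}}(\sigma)$ is the map $(\sigma,\exp(\sigma_{\mathbb C})F)\mapsto(\sigma,\exp(\sigma_{\mathbb C})\tilde F)$ where $\tilde F^{-1}=H_{\mathbb C}$, $\tilde F^0=\bigl(\bigoplus_{p\text{ even}}I^{p,-p-1}\bigr)\oplus\bigl(\bigoplus_pI^{p,-p}\bigr)$, $\tilde F^1=0$; it does not depend on the choice of $F$ in the orbit. *)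

(* Defs.v *)
From HB Require Import structures.
From mathcomp Require Import all_boot all_order all_algebra.
From mathcomp Require Export complex.
From mathcomp Require Import all_classical all_reals all_analysis.
Set Implicit Arguments.
Unset Strict Implicit.
Unset Printing Implicit Defensive.
Import Order.TTheory GRing.Theory Num.Theory numFieldNormedType.Exports.
Local Open Scope classical_set_scope.
Local Open Scope ring_scope.

(* H_Z is Z^(2n), written with column vectors in a basis in which Q has the
   matrix symp_mx; H_A is 'cV[A]_(n + n). *)

Definition symp_mx (A : pzRingType) (n : nat) : 'M[A]_(n + n) :=
  block_mx 0 1%:M (- 1%:M) 0.

Definition Qform (A : pzRingType) (n : nat) (v w : 'cV[A]_(n + n)) : A :=
  (v^T *m symp_mx A n *m w) 0 0.

(* X lies in the Lie algebra of Aut(H_A, Q). *)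
Definition in_sp (A : pzRingType) (n : nat) (X : 'M[A]_(n + n)) : Prop :=
  X^T *m symp_mx A n + symp_mx A n *m X = 0.

(* The truncation loses nothing when X is nilpotent: then X ^+ (2n) = 0. *)
Definition nilexp (K : fieldType) (n : nat) (X : 'M[K]_(n + n)) :
    'M[K]_(n + n) :=
  \sum_(k < (n + n).+1) (k`!%:R)^-1 *: X ^+ k.

Definition cplx_mx (R : rcfType) (m k : nat) (X : 'M[R]_(m, k)) :
    'M[R[i]]_(m, k) := map_mx (real_complex R) X.

Definition conj_vspace (R : rcfType) (m : nat) (U : {vspace 'cV[R[i]]_m}) :
    {vspace 'cV[R[i]]_m} :=
  <<[seq map_mx Num.conj v | v <- vbasis U]>>%VS.

Definition mxop (K : fieldType) (m : nat) (X : 'M[K]_m) : 'End('cV[K]_m) :=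
  linfun (mulmx X).

(* Increasing or decreasing families of subspaces of H_C; monotonicity is
   imposed where it is needed. *)
Definition filtration (R : realType) (n : nat) : Type :=
  int -> {vspace 'cV[R[i]]_(n + n)}.

Definition act_filtration (R : realType) (n : nat) (g : 'M[R[i]]_(n + n))
    (F : filtration R n) : filtration R n :=
  fun p => (mxop g @: F p)%VS.

(* h p stands for h^{p,-p-1}. *)
Definition hodge_numbers (n : nat) (h : int -> nat) : Prop :=
  [/\ forall p : int, h (- p - 1) = h p,
      finite_set [set p : int | h p <> 0%N]
    & \big[addn/0%N]_(p \in [set: int]) h p = (n + n)%N].

Definition siegel_numbers (n : nat) (p : int) : nat :=
  if (p == 0) || (p == -1) then n else 0%N.

Definition compact_dual (R : realType) (n : nat) (h : int -> nat) :
    set (filtration R n) :=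
  [set F : filtration R n | [/\ forall p, (F (p + 1)%R <= F p)%VS,
               forall p, \dim (F p) =
                 \big[addn/0%N]_(r \in [set r : int | p <= r]) h r
             & forall p v w, v \in F p -> w \in F (- p) -> Qform v w = 0]].
Arguments compact_dual R {n} h _.

Definition hodge_comp (R : realType) (n : nat) (F : filtration R n)
    (p q : int) : {vspace 'cV[R[i]]_(n + n)} :=
  (F p :&: conj_vspace (F q))%VS.

(* A filtration is a Hodge structure of weight k when F^p and conj F^(k+1-p)
   are opposed for all p; here k = -1. *)
Definition hodge_structure_wm1 (R : realType) (n : nat)
    (F : filtration R n) : Prop :=
  forall p, (F p + conj_vspace (F (- p)))%VS = fullv /\
            (F p :&: conj_vspace (F (- p)))%VS = 0%VS.

Definition period_domain (R : realType) (n : nat) (h : int -> nat) :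
    set (filtration R n) :=
  [set F : filtration R n | [/\ compact_dual R h F,
               hodge_structure_wm1 F
             & forall (p q : int) v, p + q = -1 -> v \in hodge_comp F p q -> v != 0 ->
                 0 < ('i%C : R[i]) ^ (p - q) * Qform v (map_mx Num.conj v)]].
Arguments period_domain R {n} h _.

(* The cone is presented by the N_j, to which the condition x_j >> 0 refers in
   generates_orbit. *)
Record nilpotent_cone (n : nat) := NilpotentCone {
  cone_size : nat;
  cone_gen : 'I_cone_size -> 'M[rat]_(n + n);
  cone_gen_sp : forall j, in_sp (cone_gen j);
  cone_gen_nil : forall j, exists k, cone_gen j ^+ k = 0;
  cone_gen_comm : forall j k,
    cone_gen j *m cone_gen k = cone_gen k *m cone_gen j }.

Definition gen_comb (K : fieldType) (n : nat) (sigma : nilpotent_cone n)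
    (x : 'I_(cone_size sigma) -> K) : 'M[K]_(n + n) :=
  \sum_j x j *: map_mx ratr (cone_gen j).

Definition cone (R : realType) (n : nat) (sigma : nilpotent_cone n) :
    set 'M[R]_(n + n) :=
  [set N : 'M[R]_(n + n) | exists2 x : 'I_(cone_size sigma) -> R,
             (forall j, 0 <= x j) & N = gen_comb x].
Arguments cone R {n} sigma _.

(* The span over K of the cone: its affine hull for K = R, and the complex
   span sigma_C for K = R[i]. *)
Definition cone_span (K : fieldType) (n : nat) (sigma : nilpotent_cone n) :
    set 'M[K]_(n + n) :=
  range (fun x : 'I_(cone_size sigma) -> K => gen_comb x).
Arguments cone_span K {n} sigma _.

Definition cone_relint (R : realType) (n : nat) (sigma : nilpotent_cone n) :
    set 'M[R]_(n + n) :=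
  [set N : 'M[R]_(n + n) | cone R sigma N /\ within (cone_span R sigma) (nbhs N) (cone R sigma)].
Arguments cone_relint R {n} sigma _.

(* The orbit (sigma, exp(sigma_C) F) is represented by the
    set exp(sigma_C) F of filtrations. *)
Definition exp_orbit (R : realType) (n : nat) (sigma : nilpotent_cone n)
    (F : filtration R n) : set (filtration R n) :=
  [set act_filtration (nilexp X) F | X in cone_span R[i] sigma].

Definition generates_orbit (R : realType) (n : nat) (h : int -> nat)
    (sigma : nilpotent_cone n) (F : filtration R n) : Prop :=
  [/\ compact_dual R h F,
      exists b : R, forall x : 'I_(cone_size sigma) -> R, (forall j, b < x j) ->
        period_domain R h
          (act_filtration (nilexp ('i%C *: cplx_mx (gen_comb x))) F)
    & forall N, cone R sigma N -> forall p,
        (mxop (cplx_mx N) @: F p <= F (p - 1)%R)%VS].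

Definition nilpotent_orbits (R : realType) (n : nat) (h : int -> nat)
    (sigma : nilpotent_cone n) : set (set (filtration R n)) :=
  [set exp_orbit sigma F | F in generates_orbit h sigma].
Arguments nilpotent_orbits R {n} h sigma _.

(* The last two clauses say that N^j induces an isomorphism from
   Gr_(-1+j) onto Gr_(-1-j). *)
Definition is_weight_filtration (R : realType) (n : nat) (N : 'M[R]_(n + n))
    (W : filtration R n) : Prop :=
  let T := cplx_mx N in
  [/\ forall k, (W k <= W (k + 1)%R)%VS,
      exists k, W k = 0%VS /\ W (- k) = fullv,
      forall k, (mxop T @: W k <= W (k - 2)%R)%VS,
      forall (j : nat) v, v \in W (-1 + j%:Z)%R ->
        T ^+ j *m v \in W (-1 - j%:Z - 1)%R -> v \in W (-1 + j%:Z - 1)%R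
    & forall j : nat, (W (-1 - j%:Z)%R
        <= mxop (T ^+ j) @: W (-1 + j%:Z)%R + W (-1 - j%:Z - 1)%R)%VS].

(* The default value is never reached when sigma generates a nilpotent orbit:
   the elements of the relative interior then share their weight filtration. *)
Definition cone_weight (R : realType) (n : nat) (sigma : nilpotent_cone n) :
    filtration R n :=
  xget (fun=> 0%VS : {vspace 'cV[R[i]]_(n + n)})
    [set W : int -> {vspace 'cV[R[i]]_(n + n)} |
       forall N, cone_relint R sigma N -> is_weight_filtration N W].
Arguments cone_weight R {n} sigma _.

(* Deligne's formula
     I^{p,q} = F^p \cap W_(p+q) \cap
       (conj F^q \cap W_(p+q) + sum_(j >= 1) conj F^(q-j) \cap W_(p+q-j-1)).
   A \big over a set is the default 0 if infinitely many terms are nonzero;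
   this does not happen here, nor in even_filtration, for bounded F and W. *)
Definition deligne_comp (R : realType) (n : nat) (W F : filtration R n)
    (p q : int) : {vspace 'cV[R[i]]_(n + n)} :=
  (F p :&: W (p + q)%R :&:
    ((conj_vspace (F q) :&: W (p + q)%R) +
     \big[addv/0%VS]_(j \in [set j : nat | (1 <= j)%N])
        (conj_vspace (F (q - j%:Z)%R) :&: W (p + q - j%:Z - 1)%R)))%VS.

Definition limit_comp (R : realType) (n : nat) (sigma : nilpotent_cone n)
    (F : filtration R n) (p q : int) : {vspace 'cV[R[i]]_(n + n)} :=
  deligne_comp (cone_weight R sigma) F p q.

Definition even_type_orbit (R : realType) (n : nat) (sigma : nilpotent_cone n)
    (F : filtration R n) : Prop :=
  (forall N, cone R sigma N -> N ^+ 2 = 0) /\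
  (forall p : int, odd `|p|%N -> limit_comp sigma F p (- p) = 0%VS).

Definition even_type_cone (R : realType) (n : nat) (h : int -> nat)
    (sigma : nilpotent_cone n) : Prop :=
  (exists F : filtration R n, generates_orbit h sigma F) /\
  (forall F : filtration R n, generates_orbit h sigma F ->
     even_type_orbit sigma F).
Arguments even_type_cone R {n} h sigma.

Definition even_filtration (R : realType) (n : nat) (sigma : nilpotent_cone n)
    (F : filtration R n) : filtration R n :=
  fun p =>
    if p <= -1 then fullv
    else if p == 0 then
      (\big[addv/0%VS]_(r \in [set r : int | ~~ odd `|r|%N])
          limit_comp sigma F r (- r - 1) +
       \big[addv/0%VS]_(r \in [set: int]) limit_comp sigma F r (- r))%VS
    else 0%VS.

(* exp(sigma_C) F |-> exp(sigma_C) F~.  The right-hand side does not depend on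
   the choice of F in the orbit; taking the union over all choices avoids
   fixing one. *)
Definition p_ev (R : realType) (n : nat) (sigma : nilpotent_cone n)
    (Z : set (filtration R n)) : set (filtration R n) :=
  \bigcup_(F in Z) exp_orbit sigma (even_filtration sigma F).

(* Main.v *)
(* Write L for F~^0, M = Im N and K = Ker N, with N in the interior of the
   cone; positivity of the Siegel orbit makes the forms -Q(N_j v, conj v)
   semidefinite, so that M and K do not depend on N and form the weight
   filtration M <= K <= H.  The Deligne splitting of (W, L) is
     H = M + A + conj A + B,   A = L :&: K = I^{0,-1},  B = I^{0,0},
   and i Q(v, conj v) is positive definite on A.  To lift L to D, keep B and M
   as I^{0,0} and I^{-1,-1}, and split A orthogonally into pieces A_r, r even,
   of dimension h^{r,-r-1} (minus dim M for r = 0, whence the rank condition),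
   putting I^{r,-r-1} = A_r for r even and conj A_(-r-1) for r odd.  The even
   part of this mixed Hodge structure is A + B = L.  For x >> 0 the points
   exp(i N_x) F and exp(i N_x) L are related in the same way, so the positivity
   needed for D is the one on the Siegel side. *)

Require Import Defs.
From mathcomp Require Import all_boot all_order all_algebra.
From mathcomp Require Import all_classical all_reals all_analysis.
From mathcomp Require Import zify ring lra.
Set Implicit Arguments.
Unset Strict Implicit.
Unset Printing Implicit Defensive.
Import Order.TTheory GRing.Theory Num.Theory numFieldNormedType.Exports.

(** * Conjugation and the symplectic form *)

(** In weight -1 the polarization sign i^{p-q} equals (-1)^p i. A point of D is thus positive for i
    Q(v, conj v) on its even components and negative on its odd ones; placing the even ones in L and
    the odd ones in conj L reduces both conditions to positivity of L. The pieces A_r are not chosen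
    one by one: a decreasing flag is cut out of a fixed basis of A, and orthogonal complements in A
    supply the odd degrees. The flag depends on L only through L :&: K. An element X of sigma_C
    kills K and maps into M, so exp(X) = 1 + X fixes K pointwise and moves only B. Hence the
    construction commutes with exp(X) for every complex X, as required by [p_ev], which runs over a
    whole orbit. Two points of analysis remain. The condition x >> 0 never isolates a generator, so
    semidefiniteness for a single N_j is read off as a slope along x + t e_j. The weight filtration
    is prescribed on the relative interior, a topological notion, which must be related to strictly
    positive combinations of possibly dependent generators. *)

Section ConjugationAndPairing.
Local Open Scope ring_scope.
Variables (R : realType) (n : nat).
Local Notation C := R[i].
Local Notation V := 'cV[C]_(n + n).
Implicit Types (u v w : V) (U W : {vspace V}).

Lemma conj_mxK v : map_mx Num.conj (map_mx Num.conj v) = v.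
Proof. by apply/matrixP => i j; rewrite !mxE conjCK. Qed.

Lemma conj_mxD u v :
  map_mx Num.conj (u + v) = map_mx Num.conj u + map_mx Num.conj v.
Proof. by rewrite map_mxD. Qed.

Lemma conj_mxZ (a : C) v :
  map_mx Num.conj (a *: v) = a^* *: map_mx Num.conj v.
Proof. by rewrite map_mxZ. Qed.

Lemma conj_mx_eq0 v : (map_mx Num.conj v == 0) = (v == 0).
Proof.
apply/eqP/eqP => [v0|->]; last by rewrite map_mx0.
by rewrite -[v]conj_mxK v0 map_mx0.
Qed.

Let memv_conj_span (X : seq V) v :
  v \in <<X>>%VS -> map_mx Num.conj v \in <<[seq map_mx Num.conj u | u <- X]>>%VS.
Proof.
move=> vX; rewrite (coord_span (X := in_tuple X) vX) raddf_sum /=.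
apply: memv_suml => i _; rewrite conj_mxZ; apply: memvZ; apply: memv_span.
by apply: map_f; apply: mem_nth.
Qed.

Lemma memv_conj U v : (v \in conj_vspace U) = (map_mx Num.conj v \in U).
Proof.
apply/idP/idP => [|vU].
  move=> /memv_conj_span; rewrite -map_comp (eq_map (g := id)); last first.
    by move=> u /=; rewrite conj_mxK.
  by rewrite map_id (span_basis (vbasisP U)).
rewrite -[v]conj_mxK; apply: memv_conj_span.
by rewrite (span_basis (vbasisP U)).
Qed.

Lemma conj_vspaceK U : conj_vspace (conj_vspace U) = U.
Proof. by apply/vspaceP => v; rewrite !memv_conj conj_mxK. Qed.

Lemma conj_vspaceS U W : (conj_vspace U <= conj_vspace W)%VS = (U <= W)%VS.
Proof.
apply/subvP/subvP => [UW v vU|UW v]; last by rewrite !memv_conj; apply: UW.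
by have := UW (map_mx Num.conj v); rewrite !memv_conj conj_mxK; apply.
Qed.

Lemma conj_vspace0 : conj_vspace (0%VS : {vspace V}) = 0%VS.
Proof. by apply/vspaceP => v; rewrite memv_conj !memv0 conj_mx_eq0. Qed.

Lemma conj_vspacef : conj_vspace (fullv : {vspace V}) = fullv.
Proof. by apply/vspaceP => v; rewrite memv_conj !memvf. Qed.

Lemma conj_vspaceD U W :
  conj_vspace (U + W)%VS = (conj_vspace U + conj_vspace W)%VS.
Proof.
apply/vspaceP => v; rewrite memv_conj; apply/memv_addP/memv_addP => -[u uU [w wW e]].
  exists (map_mx Num.conj u); first by rewrite memv_conj conj_mxK.
  exists (map_mx Num.conj w); first by rewrite memv_conj conj_mxK.
  by rewrite -conj_mxD -e conj_mxK.
exists (map_mx Num.conj u); first by rewrite -memv_conj.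
exists (map_mx Num.conj w); first by rewrite -memv_conj.
by rewrite -conj_mxD -e.
Qed.

Lemma dim_conj_vspace U : \dim (conj_vspace U) = \dim U.
Proof.
have le W : (\dim (conj_vspace W) <= \dim W)%N.
  by apply: leq_trans (dim_span _) _; rewrite size_map size_tuple.
by apply/eqP; rewrite eqn_leq le -{1}[U]conj_vspaceK le.
Qed.

Lemma dim_cVf (m : nat) : \dim (fullv : {vspace 'cV[C]_m}) = m.
Proof. by rewrite dimvf /dim /= muln1. Qed.

Lemma QformDl u v w : Qform (u + v) w = Qform u w + Qform v w.
Proof. by rewrite /Qform linearD /= !mulmxDl mxE. Qed.
Lemma QformDr u v w : Qform u (v + w) = Qform u v + Qform u w.
Proof. by rewrite /Qform !mulmxDr mxE. Qed.
Lemma QformZl (a : C) u w : Qform (a *: u) w = a * Qform u w.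
Proof. by rewrite /Qform linearZ /= -!scalemxAl mxE. Qed.
Lemma QformZr (a : C) u w : Qform u (a *: w) = a * Qform u w.
Proof. by rewrite /Qform -!scalemxAr mxE. Qed.
Lemma QformNl u w : Qform (- u) w = - Qform u w.
Proof. by rewrite -scaleN1r QformZl mulN1r. Qed.
Lemma QformNr u w : Qform u (- w) = - Qform u w.
Proof. by rewrite -scaleN1r QformZr mulN1r. Qed.
Lemma Qform0l w : Qform 0 w = 0 :> C.
Proof. by rewrite -(scale0r 0) QformZl mul0r. Qed.
Lemma Qform0r w : Qform w 0 = 0 :> C.
Proof. by rewrite -(scale0r 0) QformZr mul0r. Qed.

Lemma Qform_suml (I : Type) (r : seq I) (f : I -> V) w :
  Qform (\sum_(i <- r) f i) w = \sum_(i <- r) Qform (f i) w.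
Proof.
elim: r => [|i r IH]; first by rewrite !big_nil Qform0l.
by rewrite !big_cons QformDl IH.
Qed.

Lemma tr_symp_mx : (symp_mx C n)^T = - symp_mx C n.
Proof.
by rewrite /symp_mx tr_block_mx opp_block_mx !trmx0 linearN /= trmx1 oppr0 opprK.
Qed.

Lemma QformC u v : Qform u v = - Qform v u.
Proof.
rewrite /Qform -[in RHS](trmxK (v^T *m _ *m u)) [in RHS]mxE.
by rewrite !trmx_mul trmxK tr_symp_mx mulNmx mulmxN [in RHS]mxE opprK mulmxA.
Qed.

Lemma Qform_conj u v :
  Qform (map_mx Num.conj u) (map_mx Num.conj v) = (Qform u v)^*.
Proof.
have -> : (Qform u v)^* = (map_mx Num.conj (u^T *m symp_mx C n *m v)) 0 0.
  by rewrite mxE.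
have eS : symp_mx C n = map_mx Num.conj (symp_mx C n).
  by rewrite /symp_mx map_block_mx !map_mx0 map_mxN map_mx1.
by rewrite /Qform map_mxM [map_mx _ (u^T *m _)]map_mxM -eS map_trmx.
Qed.

Lemma Qform_sp (X : 'M[C]_(n + n)) u v :
  in_sp X -> Qform (X *m u) v = - Qform u (X *m v).
Proof.
move=> /eqP; rewrite addr_eq0 => /eqP spX.
rewrite /Qform trmx_mul -(mulmxA _ X^T) spX mulmxN mulNmx mxE.
by congr (- _); rewrite !mulmxA.
Qed.

Lemma Qform_nondeg u : (forall v, Qform u v = 0) -> u = 0.
Proof.
move=> u0; have /eqP : u^T *m symp_mx C n = 0.
  apply/rowP => j; have := u0 (delta_mx j 0).
  rewrite /Qform -colE [in X in X -> _]mxE => h; rewrite [RHS]mxE; exact: h.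
rewrite -trmx_eq0 trmx_mul trmxK tr_symp_mx mulNmx oppr_eq0 => /eqP u1.
have := congr1 (mulmx (symp_mx C n)) u1.
rewrite mulmx0 mulmxA /symp_mx mulmx_block !mul0mx !mulmx0 !mul1mx !mulmx1.
rewrite ?add0r ?addr0 => /eqP.
have -> : block_mx (- 1%:M) 0 0 (- 1%:M) = - (1%:M : 'M[C]_(n + n)).
  by rewrite [in RHS]scalar_mx_block opp_block_mx !oppr0.
by rewrite mulNmx mul1mx oppr_eq0 => /eqP.
Qed.

End ConjugationAndPairing.

(** * Orthogonal complements for the Hermitian form i Q(v, conj w) *)

Section HermitianForm.
Local Open Scope ring_scope.
Variables (R : realType) (n : nat).
Local Notation C := R[i].
Local Notation V := 'cV[C]_(n + n).
Local Notation cj := (map_mx Num.conj).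
Implicit Types (u v w : V) (U W A : {vspace V}).

Definition hnorm v : C := 'i%C * Qform v (cj v).

Lemma conj_complexi : ('i%C : C)^* = - 'i%C.
Proof. by apply/eqP; rewrite eq_complex /= oppr0 !eqxx. Qed.

Lemma complexi_neq0 : 'i%C != 0 :> C.
Proof. by rewrite eq_complex /= oner_eq0 andbF. Qed.

Lemma hnorm_conj v : hnorm (cj v) = - hnorm v.
Proof. by rewrite /hnorm conj_mxK QformC mulrN. Qed.

(** The condition is Q(w, conj u) = 0 for u in U, cut out as the kernel of the matrix whose rows are
    the functionals Q(conj u_i, -) for a basis u_i of U. *)
Definition hperp U : {vspace V} :=
  lker (linfun (mulmx (\matrix_(i < \dim U)
                         ((cj (vbasis U)`_i)^T *m symp_mx C n)))).

Lemma memv_hperp U w :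
  reflect (forall u, u \in U -> Qform w (cj u) = 0) (w \in hperp U).
Proof.
rewrite memv_ker lfunE /=.
have E i : Qform w (cj (vbasis U)`_i) =
    - ((cj (vbasis U)`_i)^T *m symp_mx C n *m w) 0 0 by rewrite QformC.
apply: (iffP eqP) => [w0 u uU|w0].
  rewrite (coord_vbasis uU) raddf_sum /= QformC Qform_suml big1 ?oppr0 // => i _.
  rewrite conj_mxZ QformZl.
  have := congr1 (row i) w0; rewrite row_mul rowK row0 => e0.
  by rewrite /Qform e0 mxE mulr0.
apply/row_matrixP => i; rewrite row_mul rowK row0; apply/rowP => j.
rewrite ord1 [RHS]mxE; apply/eqP; rewrite -oppr_eq0 -E w0 //.
by apply: vbasis_mem; apply: mem_nth; rewrite size_tuple.
Qed.

Lemma dim_cap_hperp U W : (\dim W <= \dim (W :&: hperp U) + \dim U)%N.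
Proof.
rewrite -(limg_ker_dim (linfun (mulmx (\matrix_(i < \dim U)
   ((cj (vbasis U)`_i)^T *m symp_mx C n)))) W) leq_add2l.
by apply: leq_trans (dimvS (subvf _)) _; rewrite dimvf /dim /= muln1.
Qed.

(** Counting equations gives only a lower bound. Applied to U and to a complement of U, whose
    orthogonals meet in 0 by nondegeneracy, the two bounds already exhaust the available dimension,
    so both are equalities. *)
Lemma dim_hperp U : (\dim (hperp U) + \dim U)%N = (n + n)%N.
Proof.
have dimV := dim_cVf R (n + n).
have ge W : (n + n <= \dim (hperp W) + \dim W)%N.
  by have := dim_cap_hperp W fullv; rewrite capfv dimV.
have cap0 : (hperp U :&: hperp U^C = 0)%VS.
  apply/eqP; rewrite -subv0; apply/subvP => v; rewrite memv_cap memv0.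
  move=> /andP[/memv_hperp v1 /memv_hperp v2]; apply/eqP; apply: Qform_nondeg => w.
  have : cj w \in (U + U^C)%VS by rewrite addv_complf memvf.
  move=> /memv_addP[a aU [b bU e]].
  by rewrite -[w]conj_mxK e conj_mxD QformDr v1 // v2 // addr0.
have := dimvS (subvf (hperp U + hperp U^C)); rewrite dimV (dimv_disjoint_sum cap0).
have := dimvS (subvf U); have := dimv_compl U; rewrite dimV.
by move: (ge U) (ge U^C%VS); lia.
Qed.

Section PositiveSubspace.
Variables (A : {vspace V}).
Hypothesis posA : forall v, v \in A -> v != 0 -> 0 < hnorm v.

Lemma cap_hperp0 U v : (U <= A)%VS -> v \in U -> v \in hperp U -> v = 0.
Proof.
move=> /subvP UA vU /memv_hperp v0; apply/eqP; apply/negPn/negP => vN0.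
by have := posA (UA _ vU) vN0; rewrite /hnorm v0 // mulr0 ltxx.
Qed.

(** Positivity on A keeps U apart from its orthogonal, which bounds the sum from above; counting
    equations bounds it from below. *)
Lemma dim_cap_hperp_pos U : (U <= A)%VS ->
  (\dim U + \dim (A :&: hperp U))%N = \dim A.
Proof.
move=> UA; have cap0 : (U :&: (A :&: hperp U) = 0)%VS.
  apply/eqP; rewrite -subv0; apply/subvP => v; rewrite !memv_cap memv0.
  by move=> /and3P[vU _ vp]; apply/eqP; apply: cap_hperp0 vU vp.
have le : (U + (A :&: hperp U) <= A)%VS by rewrite subv_add UA capvSl.
have := dimvS le; rewrite (dimv_disjoint_sum cap0).
by have := dim_cap_hperp U A; lia.
Qed.

Lemma add_cap_hperp U : (U <= A)%VS -> (U + (A :&: hperp U))%VS = A.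
Proof.
move=> UA; apply/eqP; rewrite eqEdim subv_add UA capvSl /=.
rewrite dimv_disjoint_sum ?dim_cap_hperp_pos //.
apply/eqP; rewrite -subv0; apply/subvP => v; rewrite !memv_cap memv0.
by move=> /and3P[vU _ vp]; apply/eqP; apply: cap_hperp0 vU vp.
Qed.

End PositiveSubspace.

Lemma hperpS U W : (U <= W)%VS -> (hperp W <= hperp U)%VS.
Proof.
move=> /subvP UW; apply/subvP => v /memv_hperp v0.
by apply/memv_hperp => u /UW; apply: v0.
Qed.

End HermitianForm.

(** * The limiting mixed Hodge structure of a Siegel orbit *)

Section LimitLagrangian.
Local Open Scope ring_scope.
Variables (R : realType) (n : nat).
Local Notation C := R[i].
Local Notation V := 'cV[C]_(n + n).
Local Notation cj := (map_mx Num.conj).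
Implicit Types (u v w : V) (U W : {vspace V}).

(** The linear data kept from a Siegel orbit: M = W_{-2}, K = W_{-1} and the limit L. Positivity is
    asked on the intersection of L with K, since L itself need not be a point of Siegel space. *)
Record limit_lagrangian (M K L : {vspace V}) : Prop := LimitLagrangian {
  conj_weightM : forall v, v \in M -> cj v \in M;
  conj_weightK : forall v, v \in K -> cj v \in K;
  weight_sub : (M <= K)%VS;
  weight_orth : forall v w, v \in M -> w \in K -> Qform v w = 0;
  dim_weight : (\dim M + \dim K)%N = (n + n)%N;
  lagrangian_isotropic : forall v w, v \in L -> w \in L -> Qform v w = 0;
  dim_lagrangian : \dim L = n;
  lagrangian_pos : forall v, v \in L -> v \in K -> v != 0 -> 0 < hnorm v }.

(* In Deligne's decomposition for the filtration L of H_C, these are I^{0,-1}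
   and I^{0,0}; the other two components are conj I^{0,-1} and M. *)
Definition lag_pure (K L : {vspace V}) : {vspace V} := (L :&: K)%VS.
Definition lag_top (M L : {vspace V}) : {vspace V} :=
  (L :&: (conj_vspace L + M))%VS.

Section Splitting.
Variables (M K L : {vspace V}).
Hypothesis LL : limit_lagrangian M K L.
Let A := lag_pure K L.
Let B := lag_top M L.

Lemma lag_pure_pos v : v \in A -> v != 0 -> 0 < hnorm v.
Proof. by rewrite memv_cap => /andP[]; apply: lagrangian_pos LL v. Qed.

Lemma lag_pure_weight v : v \in A -> v \in K.
Proof. by rewrite memv_cap => /andP[]. Qed.

Lemma lag_pure_lag v : v \in A -> v \in L.
Proof. by rewrite memv_cap => /andP[]. Qed.

Lemma lag_top_lag v : v \in B -> v \in L.
Proof. by rewrite memv_cap => /andP[]. Qed.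

Let MK v : v \in M -> v \in K.
Proof. by apply: (subvP (weight_sub LL)). Qed.

Lemma hnorm0 v : v \in A -> hnorm v = 0 -> v = 0.
Proof.
move=> vA v0; apply/eqP/negPn/negP => /(lag_pure_pos vA).
by rewrite v0 ltxx.
Qed.

Lemma lag_top_decomp b : b \in B ->
  exists2 l, l \in L & exists2 m, m \in M & b = cj l + m.
Proof.
rewrite memv_cap => /andP[_ /memv_addP[l lL [m mM ->]]].
exists (cj l); first by rewrite -memv_conj.
by exists m => //; rewrite conj_mxK.
Qed.

(** I^{0,0} is real modulo W_{-2}: if b = conj l + m, then l itself lies in B, and conj b differs
    from it by conj m. *)
Lemma conj_lag_top b : b \in B ->
  exists2 b', b' \in B & exists2 m, m \in M & cj b = b' + m.
Proof.
move=> bB; have [l lL [m mM e]] := lag_top_decomp bB.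
exists l; last by exists (cj m); [apply: conj_weightM LL _ _ | rewrite e conj_mxD conj_mxK].
rewrite memv_cap lL; apply/memv_addP; exists (cj b).
  by rewrite memv_conj conj_mxK lag_top_lag.
exists (- cj m); first by rewrite memvN; apply: conj_weightM LL _ _.
by rewrite e conj_mxD conj_mxK addrK.
Qed.

Lemma lag_top_sub_conj b : b \in B ->
  exists2 b', b' \in B & exists2 m, m \in M & b = cj b' + m.
Proof.
move=> /conj_lag_top[b' b'B [m mM e]]; exists b' => //; exists (cj m).
  exact: conj_weightM LL _ _.
by rewrite -conj_mxD -e conj_mxK.
Qed.

Lemma Qform_top_conj_pure b a : b \in B -> a \in A -> Qform b (cj a) = 0.
Proof.
move=> /lag_top_decomp[l lL [m mM ->]] aA.
rewrite QformDl Qform_conj (lagrangian_isotropic LL lL (lag_pure_lag aA)).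
rewrite (weight_orth LL mM) ?addr0 ?rmorph0 //.
by apply: conj_weightK LL _ (lag_pure_weight aA).
Qed.

(** The components are peeled off by pairing. A vanishing sum forces b into K, hence into A, and B
    is orthogonal to conj A, so b is null there. Pairing with conj a and then with a' leaves
    [hnorm a] and [hnorm a'], because M is orthogonal to K and L is isotropic. *)
Lemma lag_split_uniq m a a' b : m \in M -> a \in A -> a' \in A -> b \in B ->
  m + a + cj a' + b = 0 -> [/\ m = 0, a = 0, a' = 0 & b = 0].
Proof.
move=> mM aA a'A bB e.
have mK := MK mM; have aK := lag_pure_weight aA; have a'K := lag_pure_weight a'A.
have ca'K : cj a' \in K by apply: conj_weightK LL _ _.
have bA : b \in A.
  rewrite memv_cap lag_top_lag //=.
  have -> : b = - (m + a + cj a') by apply/eqP; rewrite -addr_eq0 addrC e.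
  by rewrite memvN !memvD.
have b0 : b = 0.
  apply: hnorm0 => //.
  by rewrite /hnorm Qform_top_conj_pure ?mulr0.
move: e; rewrite b0 addr0 => e.
have a0 : a = 0.
  apply: hnorm0 => //; have := congr1 (fun x => Qform x (cj a)) e.
  rewrite Qform0l !QformDl (weight_orth LL mM (conj_weightK LL aK)) add0r.
  rewrite Qform_conj (lagrangian_isotropic LL (lag_pure_lag a'A) (lag_pure_lag aA)).
  by rewrite rmorph0 addr0 /hnorm => ->; rewrite mulr0.
move: e; rewrite a0 addr0 => e.
have a'0 : a' = 0.
  apply: hnorm0 => //; have := congr1 (Qform a') e.
  rewrite Qform0r QformDr QformC (weight_orth LL mM a'K) oppr0 add0r /hnorm.
  by move=> ->; rewrite mulr0.
by move: e; rewrite a'0 map_mx0 addr0.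
Qed.

Lemma lag_split_inj m1 a1 a1' b1 m2 a2 a2' b2 :
  m1 \in M -> a1 \in A -> a1' \in A -> b1 \in B ->
  m2 \in M -> a2 \in A -> a2' \in A -> b2 \in B ->
  m1 + a1 + cj a1' + b1 = m2 + a2 + cj a2' + b2 ->
  [/\ m1 = m2, a1 = a2, a1' = a2' & b1 = b2].
Proof.
move=> m1M a1A a1A' b1B m2M a2A a2A' b2B /eqP e.
have [] := @lag_split_uniq (m1 - m2) (a1 - a2) (a1' - a2') (b1 - b2).
- by rewrite rpredB.
- by rewrite rpredB.
- by rewrite rpredB.
- by rewrite rpredB.
- move: e; rewrite -subr_eq0 => /eqP <-; rewrite map_mxB !opprD.
  by rewrite [RHS]addrACA; congr (_ + _); rewrite [RHS]addrACA (addrACA m1).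
by move=> /subr0_eq -> /subr0_eq -> /subr0_eq -> /subr0_eq ->.
Qed.

Lemma dim_lag_split (M' A1 A2 B' : {vspace V}) :
  (M' <= M)%VS -> (A1 <= A)%VS -> (A2 <= A)%VS -> (B' <= B)%VS ->
  \dim (M' + A1 + conj_vspace A2 + B') =
  (\dim M' + \dim A1 + \dim A2 + \dim B')%N.
Proof.
move=> /subvP sM /subvP s1 /subvP s2 /subvP sB.
rewrite !dimv_disjoint_sum ?dim_conj_vspace //; apply/eqP;
  rewrite -subv0; apply/subvP => v; rewrite memv_cap memv0 => /andP[].
- move=> vM vA; have [] := @lag_split_uniq v (- v) 0 0.
  + exact: sM.
  + by rewrite memvN s1.
  + exact: mem0v.
  + exact: mem0v.
  + by rewrite map_mx0 subrr !addr0.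
  by move=> -> _ _ _.
- move=> /memv_addP[m mM [a aA ->]]; rewrite memv_conj => vA.
  have [] := @lag_split_uniq m a (- cj (m + a)) 0.
  + exact: sM.
  + exact: s1.
  + by rewrite memvN s2.
  + exact: mem0v.
  + by rewrite map_mxN conj_mxK addr0 subrr.
  by move=> -> -> _ _; rewrite addr0.
move=> /memv_addP[x /memv_addP[m mM [a aA ->]] [a' a'A ->]] vB.
have [] := @lag_split_uniq m a (cj a') (- (m + a + a')).
- exact: sM.
- exact: s1.
- by apply: s2; rewrite -memv_conj.
- by rewrite memvN sB.
- by rewrite conj_mxK subrr.
by move=> _ _ _ /eqP; rewrite oppr_eq0.
Qed.

Let dimV : \dim (fullv : {vspace V}) = (n + n)%N.
Proof. exact: dim_cVf. Qed.

(** With m, a, b the dimensions of M, A, B: intersecting L with K gives a >= n - m, and M + A + conj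
    A inside K gives a <= n - m. Intersecting L with the direct sum conj L + M gives b >= m, and
    directness of the whole splitting gives b <= m. *)
Let dims : [/\ (\dim A + \dim M)%N = n, \dim B = \dim M
  & (M + A + conj_vspace A + B)%VS = fullv].
Proof.
have h1 := dimv_sum_cap L K.
have h1' := dimvS (subvf (L + K)); rewrite dimV in h1'.
have h2 : (\dim M + \dim A + \dim A <= \dim K)%N.
  have := dim_lag_split (subvv M) (subvv A) (subvv A) (sub0v B).
  rewrite dimv0 addn0 addv0 => <-; apply: dimvS; rewrite !subv_add (weight_sub LL) /=.
  rewrite capvSr; apply/subvP => v; rewrite memv_conj => /lag_pure_weight vK.
  by rewrite -[v]conj_mxK; apply: conj_weightK LL _ vK.
have h3 : (conj_vspace L :&: M = 0)%VS.
  apply/eqP; rewrite -subv0; apply/subvP => v; rewrite memv_cap memv_conj memv0.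
  move=> /andP[vL vM]; have cM := conj_weightM LL vM.
  have cA : cj v \in A by rewrite memv_cap vL MK.
  rewrite -conj_mx_eq0; apply/eqP/(hnorm0 cA).
  by rewrite /hnorm conj_mxK (weight_orth LL cM) ?mulr0 // MK.
have h4 := dimv_sum_cap L (conj_vspace L + M).
rewrite (dimv_disjoint_sum h3) dim_conj_vspace in h4.
have h4' := dimvS (subvf (L + (conj_vspace L + M))); rewrite dimV in h4'.
have h5 := dim_lag_split (subvv M) (subvv A) (subvv A) (subvv B).
have h5' := dimvS (subvf (M + A + conj_vspace A + B)); rewrite dimV in h5'.
have dK := dim_weight LL; have dL := dim_lagrangian LL.
rewrite -/(lag_pure K L) -/A in h1; rewrite -/(lag_top M L) -/B in h4.
rewrite h5 in h5'.
have arith (a b m k l x y : nat) : (x + a = l + k)%N -> (x <= n + n)%N ->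
    (m + a + a <= k)%N -> (y + b = l + (l + m))%N -> (y <= n + n)%N ->
    (m + a + a + b <= n + n)%N -> (m + k = n + n)%N -> l = n ->
    [/\ (a + m)%N = n, b = m & (n + n <= m + a + a + b)%N].
  by move=> *; split; lia.
have [dA dB dS] := arith _ _ _ _ _ _ _ h1 h1' h2 h4 h4' h5' dK dL.
by split=> //; apply/eqP; rewrite eqEdim subvf dimV h5.
Qed.

Lemma dim_lag_pure : (\dim A + \dim M)%N = n. Proof. by case: dims. Qed.
Lemma dim_lag_top : \dim B = \dim M. Proof. by case: dims. Qed.

Lemma lag_split_full : (M + A + conj_vspace A + B)%VS = fullv.
Proof. by case: dims. Qed.

Lemma lag_splitP v : exists m a a' b,
  [/\ m \in M, a \in A, a' \in A, b \in B & v = m + a + cj a' + b].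
Proof.
have := memvf v; rewrite -lag_split_full.
move=> /memv_addP[x /memv_addP[y /memv_addP[m mM [a aA ->]] [c cA ->]] [b bB ->]].
by exists m, a, (cj c), b; split=> //; rewrite ?conj_mxK // -memv_conj.
Qed.

(** The part m + conj a' of l outside A + B lies in both L and K, hence in A; uniqueness of the
    splitting then makes it vanish. *)
Lemma lag_decomp l : l \in L -> exists2 a, a \in A & exists2 b, b \in B & l = a + b.
Proof.
move=> lL; have [m [a [a' [b [mM aA a'A bB e]]]]] := lag_splitP l.
have xA : m + cj a' \in A.
  rewrite memv_cap; apply/andP; split.
    have -> : m + cj a' = l - a - b by rewrite e [RHS]addrAC addrK (addrAC m) addrK.
    by rewrite !rpredB //; [apply: lag_pure_lag | apply: lag_top_lag].
  by apply: rpredD; [apply: MK | apply: conj_weightK LL _ (lag_pure_weight a'A)].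
have [] := @lag_split_uniq m (- (m + cj a')) a' 0 => //.
- by rewrite memvN.
- exact: mem0v.
- by rewrite addr0 opprD addrA subrr sub0r addNr.
move=> m0 _ a'0 _; exists a => //; exists b => //.
by rewrite e m0 a'0 map_mx0 add0r addr0.
Qed.

Lemma lag_top_weight0 b : b \in B -> b \in K -> b = 0.
Proof.
move=> bB bK; have bA : b \in A by rewrite memv_cap lag_top_lag.
have [] := @lag_split_uniq 0 (- b) 0 b; rewrite ?mem0v ?memvN //.
by rewrite map_mx0 add0r addr0 addNr.
Qed.

End Splitting.
End LimitLagrangian.

(** * The lifted filtration *)

(* Failing unifications of memberships otherwise unfold down to Gaussian
   elimination. *)
#[local] Opaque subsetv.

Section FinitelySupportedSums.
Local Open Scope classical_set_scope.
Local Open Scope ring_scope.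
Variables (K : fieldType) (vT : vectType K) (I : choiceType).
Implicit Types (P : set I) (F : I -> {vspace vT}) (U : {vspace vT}).

(** An infinitely supported family sums to the default 0, which also lies in U; the finiteness in
    [fsbigv_sup] is there to exclude this default. *)
Lemma fsbigv_sub P F U : (forall i, P i -> (F i <= U)%VS) ->
  (\big[addv/0%VS]_(i \in P) F i <= U)%VS.
Proof.
move=> FU; rewrite fsbig_mkcond.
apply: (big_ind (fun X => is_true (X <= U)%VS)) => [|X Y XU YU|i _].
- exact: sub0v.
- by rewrite subv_add XU.
rewrite /patch; case: ifPn => [|_]; last exact: sub0v.
by rewrite inE => /FU.
Qed.

Lemma fsbigv_sup P F i : finite_set (P `&` F @^-1` [set~ 0%VS]) -> P i ->
  (F i <= \big[addv/0%VS]_(j \in P) F j)%VS.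
Proof.
move=> fin Pi; have [->|Fi0] := eqVneq (F i) 0%VS; first exact: sub0v.
rewrite fsbig_supp (fsbigD1 i) ?addvSl //=.
by split=> //; apply/eqP.
Qed.

Lemma finite_int_interval (N : nat) :
  finite_set [set p : int | (`|p| <= N)%N].
Proof.
pose s := [seq k%:Z | k <- iota 0 N.+1] ++ [seq - k%:Z | k <- iota 0 N.+1].
apply: (@sub_finite_set _ _ [set` s]); last exact: finite_seq.
move=> p /= pN; rewrite mem_cat; apply/orP; have [p0|p0] := lerP 0 p.
  by left; apply/mapP; exists `|p|%N; rewrite ?mem_iota; lia.
by right; apply/mapP; exists `|p|%N; rewrite ?mem_iota; lia.
Qed.

End FinitelySupportedSums.

(** * Deligne components for weights 0, -1, -2 *)

Section DeligneSplitting.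
Local Open Scope ring_scope.
Variables (R : realType) (n : nat).
Local Notation C := R[i].
Local Notation V := 'cV[C]_(n + n).
Variables (M K : {vspace V}) (W : filtration R n).

Definition two_step_weight : Prop :=
  [/\ forall k, 0 <= k -> W k = fullv, W (-1) = K, W (-2) = M
    & forall k, k <= -3 -> W k = 0%VS].
Hypothesis WMK : two_step_weight.

(** All correction terms lie in W_k with k <= -3. *)
Lemma deligne_comp_pure (F : filtration R n) p :
  deligne_comp W F p (- p - 1) =
  (F p :&: K :&: (conj_vspace (F (- p - 1)) :&: K))%VS.
Proof.
case: WMK => _ W1 _ W3; rewrite /deligne_comp.
have -> : p + (- p - 1) = -1 by lia.
rewrite W1 fsbig1 ?addv0 // => j /= j1.
by rewrite W3 ?capv0 //; lia.
Qed.

(** Only the correction term j = 1 survives, with W_{-2} = M. *)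
Lemma deligne_comp_top (F : filtration R n) p :
  deligne_comp W F p (- p) =
  (F p :&: (conj_vspace (F (- p)) + (conj_vspace (F (- p - 1)) :&: M)))%VS.
Proof.
case: WMK => W0 _ W2 W3; rewrite /deligne_comp.
have -> : p + - p = 0 by lia.
rewrite W0 // !capvf -(fsbig_widen [set 1%N]%classic); last 2 first.
- by move=> j /= ->.
- by move=> j [/= j1 jN1]; rewrite W3 ?capv0 //; lia.
by rewrite fsbig_set1 W2.
Qed.

End DeligneSplitting.

(** * The lift as a point of the compact dual, and its even part *)

Section HodgeFiltration.
Local Open Scope ring_scope.
Variables (R : realType) (n : nat).
Local Notation C := R[i].
Local Notation V := 'cV[C]_(n + n).
Local Notation cj := (map_mx Num.conj).
Implicit Types (v w : V) (p q : int).

(* pure_piece p collects the part of A = I^{0,-1} that receives even Hodge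
   degrees >= p, and pure_copiece p its orthogonal complement in A; the summand
   conj (pure_copiece (- p)) of hfil consists of the odd degrees >= p. *)
Definition pure_piece (K L : {vspace V}) (alpha : int -> nat) p : {vspace V} :=
  <<take (alpha p) (vbasis (lag_pure K L))>>%VS.

Definition pure_copiece (K L : {vspace V}) (alpha : int -> nat) p : {vspace V} :=
  (lag_pure K L :&: hperp (pure_piece K L alpha p))%VS.

Definition hfil (M K L : {vspace V}) (alpha : int -> nat) : filtration R n :=
  fun p => ((if (p < 0)%R then M else 0%VS) + pure_piece K L alpha p
    + conj_vspace (pure_copiece K L alpha (- p)%R)
    + (if (p <= 0)%R then lag_top M L else 0%VS))%VS.

(** Here r stands for the dimension of M and [alpha p] for that of [pure_piece p]. The complement at
    -p has dimension n - r - alpha(-p), so [profile_dim] is the dimension formula for F^p with the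
    subtraction moved across; [profile_odd] lets the flag drop from p to p + 1 for even p only. *)
Record even_profile (h : int -> nat) (r : nat) (alpha : int -> nat) : Prop :=
  EvenProfile {
    profile_le : forall p, (alpha p + r <= n)%N;
    profile_anti : forall p, (alpha (p + 1)%R <= alpha p)%N;
    profile_odd : forall p, odd `|p|%N -> alpha p = alpha (p + 1)%R;
    profile_dim : forall p,
      ((if (p < 0)%R then r else 0) + alpha p + (if (p <= 0)%R then r else 0) + n
       = \big[addn/0%N]_(s \in [set s : int | (p <= s)%R]%classic) h s
         + r + alpha (- p)%R)%N;
    profile_bound : exists N : nat, forall p, N%:Z <= p ->
      alpha p = 0%N /\ (alpha (- p)%R + r)%N = n }.

Variables (M K L : {vspace V}) (h : int -> nat) (alpha : int -> nat).
Hypothesis LL : limit_lagrangian M K L.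
Hypothesis prof : even_profile h (\dim M) alpha.
Let A := lag_pure K L.
Let B := lag_top M L.
Let P := pure_piece K L alpha.
Let D := pure_copiece K L alpha.
Let F := hfil M K L alpha.

Lemma pure_piece_sub p : (P p <= A)%VS.
Proof.
apply/span_subvP => v /mem_take; exact: vbasis_mem.
Qed.

Let PA p v : v \in P p -> v \in A. Proof. exact: (subvP (pure_piece_sub p)). Qed.
Let DA p v : v \in D p -> v \in A. Proof. by rewrite memv_cap => /andP[]. Qed.

Lemma dim_pure_piece p : \dim (P p) = alpha p.
Proof.
have fA := basis_free (vbasisP A).
have : free (take (alpha p) (vbasis A)).
  by move: fA; rewrite -{1}(cat_take_drop (alpha p) (vbasis A)) => /catl_free.
rewrite /free => /eqP ->; rewrite size_take size_tuple.
have := profile_le prof p; have := dim_lag_pure LL; rewrite -/A.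
by case: ltnP => //; lia.
Qed.

Lemma pure_piece_anti p q : p <= q -> (P q <= P p)%VS.
Proof.
move=> pq; have le : (alpha q <= alpha p)%N.
  have -> : q = p + `|q - p|%N%:Z by lia.
  elim: `|q - p|%N => [|k IH]; first by rewrite addr0.
  apply: leq_trans IH; have -> : p + k.+1%:Z = p + k%:Z + 1 by lia.
  exact: profile_anti prof _.
apply: sub_span => v; rewrite -(take_takel _ le); exact: mem_take.
Qed.

Lemma pure_piece_odd p : odd `|p|%N -> P p = P (p + 1).
Proof. by move=> po; rewrite /P /pure_piece (profile_odd prof po). Qed.

Lemma pure_copiece_odd p : odd `|p|%N -> D p = D (p + 1).
Proof. by move=> po; rewrite /D /pure_copiece -!/(P _) (pure_piece_odd po). Qed.

Lemma pure_copiece_mono p q : p <= q -> (D p <= D q)%VS.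
Proof. by move=> pq; exact: capvS (subvv _) (hperpS (pure_piece_anti pq)). Qed.

Lemma pure_piece_copiece p v : v \in P p -> v \in D p -> v = 0.
Proof.
move=> vP; rewrite memv_cap => /andP[_ vD].
exact: (cap_hperp0 (lag_pure_pos LL) (pure_piece_sub p) vP vD).
Qed.

Lemma pure_pieceD p : (P p + D p)%VS = A.
Proof. by rewrite (add_cap_hperp (lag_pure_pos LL)) // pure_piece_sub. Qed.

Lemma dim_pure_copiece p : (alpha p + \dim (D p) + \dim M = n)%N.
Proof.
have := dim_cap_hperp_pos (lag_pure_pos LL) (pure_piece_sub p).
by rewrite dim_pure_piece -/(D p) => ->; exact: dim_lag_pure LL.
Qed.

Lemma memv_copiece p v :
  v \in D p <-> v \in A /\ (forall w, w \in P p -> Qform v (cj w) = 0).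
Proof.
by rewrite memv_cap; split=> [/andP[-> /memv_hperp]|[-> v0]] //; apply/memv_hperp.
Qed.

#[local] Opaque pure_piece pure_copiece lag_pure lag_top hperp.

Let memv_if (c : bool) (U : {vspace V}) v :
  (v \in (if c then U else 0%VS)) <-> (v \in U /\ (~~ c -> v = 0)).
Proof.
case: c => /=; first by split=> [|[]].
by rewrite memv0; split=> [/eqP ->|[_ ->]] //; split=> //; exact: mem0v.
Qed.

Lemma hfilP p v : v \in F p <-> exists m a a' b,
  [/\ m \in M /\ (0 <= p -> m = 0), a \in P p, a' \in D (- p),
      b \in B /\ (0 < p -> b = 0) & v = m + a + cj a' + b].
Proof.
split.
  move=> /memv_addP[x /memv_addP[y /memv_addP[m /memv_if[mM m0] [a aP ->]]
    [c cD ->]] [b /memv_if[bB b0] ->]].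
  exists m, a, (cj c), b; split=> //.
  - by split=> // p0; apply: m0; rewrite -leNgt.
  - by rewrite -memv_conj.
  - by split=> // p0; apply: b0; rewrite -ltNge.
  - by rewrite conj_mxK.
move=> [m [a [a' [b [[mM m0] aP a'D [bB b0] ->]]]]].
apply: memv_add; first (apply: memv_add; first apply: memv_add) => //.
- by apply/memv_if; split=> //; rewrite -leNgt.
- by rewrite memv_conj conj_mxK.
- by apply/memv_if; split=> //; rewrite -ltNge.
Qed.

(** Conjugation exchanges the parts in A and conj A and moves B by elements of M. For q = 0 a
    component in M can therefore appear, whence 0 < q where [hfilP] has 0 <= p. *)
Lemma conj_hfilP q v : v \in conj_vspace (F q) -> exists m a a' b,
  [/\ m \in M /\ (0 < q -> m = 0), a \in D (- q), a' \in P q,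
      b \in B /\ (0 < q -> b = 0) & v = m + a + cj a' + b].
Proof.
rewrite memv_conj => /hfilP[m [a [a' [b [[mM m0] aP a'D [bB b0] e]]]]].
have [b' b'B [m' m'M e']] := conj_lag_top LL bB.
have e'0 : 0 < q -> m' = 0 /\ b' = 0.
  move=> q0; move: e'; rewrite (b0 q0) map_mx0 => /esym e'.
  have [] := @lag_split_uniq _ _ _ _ _ LL m' 0 0 b'; rewrite ?mem0v //.
  by rewrite map_mx0 !addr0 addrC.
exists (cj m + m'), a', a, b'; split.
- split; first by apply: rpredD; [apply: conj_weightM LL _ mM | exact: m'M].
  by move=> q0; rewrite m0 ?(ltW q0) // map_mx0 add0r; case: (e'0 q0).
- exact: a'D.
- exact: aP.
- by split; [exact: b'B | move=> /e'0[]].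
rewrite -[v]conj_mxK e !conj_mxD conj_mxK e' (addrC b') addrA; congr (_ + _).
by rewrite [LHS]addrAC (addrAC _ (cj a) m') [LHS]addrAC.
Qed.

(** The element y stands for the correction term of Deligne's formula; y = 0 gives the plain
    intersection of F^p with conj F^q. *)
Lemma hfil_conj_cap p q v x y :
  v \in F p -> x \in conj_vspace (F q) -> y \in M -> v = x + y ->
  exists m a a' b,
  [/\ [/\ m \in M, 0 <= p -> m = 0 & 0 < q -> m = y],
      a \in P p /\ a \in D (- q), a' \in D (- p) /\ a' \in P q,
      [/\ b \in B, 0 < p -> b = 0 & 0 < q -> b = 0] & v = m + a + cj a' + b].
Proof.
move=> /hfilP[m [a [a' [b [[mM m0] aP a'D [bB b0] ev]]]]].
move=> /conj_hfilP[m1 [a1 [a1' [b1 [[m1M m10] a1D a1'P [b1B b10] ex]]]]] yM.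
rewrite ev ex (addrAC _ b1) (addrAC _ (cj a1')) (addrAC m1) => e.
have [] := lag_split_inj LL mM (PA aP) (DA a'D) bB
                         (rpredD m1M yM) (DA a1D) (PA a1'P) b1B e.
move=> em ea ea' eb; exists m, a, a', b; split.
- by split; [exact: mM | exact: m0 | move=> q0; rewrite em m10 // add0r].
- by split; [exact: aP | rewrite ea].
- by split; [exact: a'D | rewrite ea'].
- by split; [exact: bB | exact: b0 | move=> q0; rewrite eb b10].
- by [].
Qed.

Lemma hfil_anti p : (F (p + 1)%R <= F p)%VS.
Proof.
apply/subvP => v /hfilP[m [a [a' [b [[mM m0] aP a'D [bB b0] ->]]]]].
apply/hfilP; exists m, a, a', b; split.
- by split; [exact: mM | move=> p0; apply: m0; lia].
- by apply: subvP aP; apply: pure_piece_anti; lia.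
- by apply: subvP a'D; apply: pure_copiece_mono; lia.
- by split; [exact: bB | move=> p0; apply: b0; lia].
- by [].
Qed.

Lemma dim_hfil p :
  \dim (F p) = (\big[addn/0]_(s \in [set s : int | (p <= s)%R]%classic) h s)%N.
Proof.
rewrite /F /hfil (dim_lag_split LL).
- have arith (x a y k t r a' d : nat) : (x + a + y + k = t + r + a')%N ->
      (a' + d + r = k)%N -> (x + a + d + y = t)%N by lia.
  rewrite dim_pure_piece; apply: arith (dim_pure_copiece (- p)).
  rewrite -(profile_dim prof p); congr (_ + _ + _ + _)%N.
    by case: ifP; rewrite ?dimv0.
  by case: ifP; rewrite ?dimv0 // (dim_lag_top LL).
- by case: ifP => // _; rewrite ?subvv ?sub0v.
- exact: pure_piece_sub.
- by apply/subvP => v; apply: DA.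
- by case: ifP => // _; rewrite ?subvv ?sub0v.
Qed.

Let Lag v w : v \in L -> w \in L -> Qform v w = 0.
Proof. exact: lagrangian_isotropic LL v w. Qed.
Let AL v : v \in A -> v \in L. Proof. exact: lag_pure_lag. Qed.
Let AK v : v \in A -> v \in K. Proof. exact: lag_pure_weight. Qed.
Let cAK v : v \in A -> cj v \in K.
Proof. by move=> /AK; apply: conj_weightK LL v. Qed.
Let MK v : v \in M -> v \in K. Proof. exact: (subvP (weight_sub LL)). Qed.
Let cM v : v \in M -> cj v \in M. Proof. exact: conj_weightM LL v. Qed.
Let BL v : v \in B -> v \in L. Proof. exact: lag_top_lag. Qed.

(** Between A and conj A the pairing vanishes because each flag step faces its own orthogonal
    complement. B against M is settled by degrees: b = 0 if p > 0, and the second vector has no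
    component in M if p = 0. The other pairs vanish since L is isotropic, M is orthogonal to K, and
    B is orthogonal to conj A. *)
Lemma hfil_isotropic p v w : v \in F p -> w \in F (- p) -> Qform v w = 0.
Proof.
wlog p0 : p v w / 0 <= p.
  move=> IH; have [p0|p0] := lerP 0 p; first exact: IH.
  move=> vF wF; rewrite QformC (IH (- p) w v) ?oppr0 ?opprK //; lia.
move=> /hfilP[m [a [a' [b [[mM m0] aP a'D [bB b0] ->]]]]].
move=> /hfilP[m2 [a2 [a2' [b2 [[m2M m20] a2P a2'D [b2B b20] ->]]]]].
rewrite opprK in a2'D; have [aA a2A a'A a2'A] := And4 (PA aP) (PA a2P) (DA a'D) (DA a2'D).
have e1 : Qform (cj a') a2 = 0.
  rewrite -[a2]conj_mxK Qform_conj; have /memv_copiece[_ ->] := a'D => //.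
  by rewrite rmorph0.
have e2 : Qform a (cj a2') = 0.
  rewrite QformC -[a]conj_mxK Qform_conj; have /memv_copiece[_ ->] := a2'D => //.
  by rewrite rmorph0 oppr0.
have eb : Qform b m2 = 0.
  have [p1|p1] := ltrP 0 p; first by rewrite b0 // Qform0l.
  by rewrite m20 ?Qform0r // oppr_ge0.
rewrite (m0 p0) add0r !QformDl !QformDr e1 e2 eb.
rewrite (Lag (AL aA) (AL a2A)) (Lag (AL aA) (BL b2B)).
rewrite (Lag (BL bB) (AL a2A)) (Lag (BL bB) (BL b2B)).
rewrite (Qform_top_conj_pure LL bB a2'A) Qform_conj (Lag (AL a'A) (AL a2'A)) rmorph0.
rewrite (QformC (cj a') b2) (Qform_top_conj_pure LL b2B a'A).
rewrite (QformC a) (weight_orth LL m2M (AK aA)).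
by rewrite (QformC (cj a') m2) (weight_orth LL m2M (cAK a'A)) !oppr0 !addr0.
Qed.

Lemma compact_dual_hfil : compact_dual R h F.
Proof.
split; [exact: hfil_anti | exact: dim_hfil | exact: hfil_isotropic].
Qed.

Lemma weightM_sub_hfil p : (p < 0)%R -> (M <= F p)%VS.
Proof.
move=> p0; rewrite /F /hfil p0.
exact: subv_trans (addvSl _ _) (subv_trans (addvSl _ _) (addvSl _ _)).
Qed.

Lemma piece_sub_hfil p : (P p <= F p)%VS.
Proof.
exact: subv_trans (addvSr _ _) (subv_trans (addvSl _ _) (addvSl _ _)).
Qed.

Lemma copiece_sub_hfil p : (conj_vspace (D (- p)%R) <= F p)%VS.
Proof. exact: subv_trans (addvSr _ _) (addvSl _ _). Qed.

Lemma lag_top_sub_hfil p : (p <= 0)%R -> (B <= F p)%VS.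
Proof. by move=> p0; rewrite /F /hfil p0 addvSr. Qed.

Lemma hfil_sub_weightK p : 0 < p -> (F p <= K)%VS.
Proof.
move=> p0; apply/subvP => v /hfilP[m [a [a' [b [[mM _] aP a'D [_ b0] ->]]]]].
rewrite b0 // addr0; apply: rpredD; last exact: cAK (DA a'D).
by apply: rpredD; [exact: MK mM | exact: AK (PA aP)].
Qed.

(** For p > 0 the space F^p lies in K and is killed; for p <= 0 the target F^(p-1) contains M. *)
Lemma hfil_transverse (X : 'M[C]_(n + n)) p :
  (forall v, X *m v \in M) -> (forall v, v \in K -> X *m v = 0) ->
  (mxop X @: F p <= F (p - 1)%R)%VS.
Proof.
move=> XM XK; apply/subvP => _ /memv_imgP[v vF ->]; rewrite lfunE /=.
have [p0|p0] := ltrP 0 p.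
  by rewrite XK ?mem0v //; apply: (subvP (hfil_sub_weightK p0)).
by apply: (subvP (weightM_sub_hfil _)) => //; lia.
Qed.

Section EvenPart.
Variable W : filtration R n.
Hypothesis WMK : two_step_weight M K W.

Lemma deligne_pure_sub p : ~~ odd `|p|%N ->
  (deligne_comp W F p (- p - 1)%R <= L)%VS.
Proof.
move=> pe; rewrite (deligne_comp_pure WMK); apply/subvP => v.
have qpos : p < 0 -> 0 < - p - 1 by lia.
have qodd : odd `|- p - 1|%N by lia.
rewrite !memv_cap => /andP[/andP[vF vK] /andP[vcF _]].
have [m [a [a' [b [[mM m0 m0'] [aP aD] [a'D a'P] [bB _ _] e]]]]] :=
  hfil_conj_cap vF vcF (mem0v M) (esym (addr0 v)).
have b0 : b = 0.
  apply: (lag_top_weight0 LL bB); have -> : b = v - (m + a + cj a').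
    by rewrite e addrC addKr.
  apply: rpredB => //; apply: rpredD; last exact: cAK (DA a'D).
  by apply: rpredD; [exact: MK mM | exact: AK (PA aP)].
have em : m = 0.
  have [p0|p0] := lerP 0 p; first exact: m0.
  by apply: m0'; apply: qpos.
(* As q = -p - 1 is odd, D q = D (q + 1) = D (-p), so a' lies in both P q and D q. *)
have a'0 : a' = 0.
  apply: (pure_piece_copiece a'P); 
  by move: a'D; rewrite -{1}(subrK 1 (- p)) -(pure_copiece_odd qodd).
by rewrite e em b0 a'0 map_mx0 add0r !addr0; exact: AL (PA aP).
Qed.

Lemma deligne_top_sub p : (deligne_comp W F p (- p)%R <= L)%VS.
Proof.
rewrite (deligne_comp_top WMK); apply/subvP => v.
have qge0 : p < 0 -> 0 <= - p - 1 by lia.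
have qpos : p < 0 -> 0 < - p by lia.
rewrite memv_cap => /andP[vF /memv_addP[x xF [y]]].
rewrite memv_cap => /andP[yF yM] e.
have [m [a [a' [b [[mM m0 m0'] [aP aD] [a'D a'P] [bB b0 b0'] ev]]]]] :=
  hfil_conj_cap vF xF yM e.
rewrite opprK in aD.
have a0 := pure_piece_copiece aP aD; have a'0 := pure_piece_copiece a'P a'D.
(* For p < 0 the component m equals y, which lies in M and in conj F^(-p-1); since -p - 1 >= 0, that
   filtration step contains no part of M. *)
have em : m = 0.
  have [p0|p0] := lerP 0 p; first exact: m0.
  move: yF; rewrite memv_conj => /hfilP.
  move=> [m1 [a1 [a1' [b1 [[_ m10] a1P a1'D [b1B _] e1]]]]].
  rewrite (m10 (qge0 p0)) add0r in e1.
  have [] := @lag_split_uniq _ _ _ _ _ LL (- cj y) a1 a1' b1.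
  - by rewrite memvN cM.
  - exact: PA a1P.
  - exact: DA a1'D.
  - exact: b1B.
  - by rewrite -!addrA (addrA a1) -e1 addNr.
  move=> /eqP; rewrite oppr_eq0 conj_mx_eq0 => /eqP y0 _ _ _.
  by rewrite (m0' (qpos p0)).
by rewrite ev em a0 a'0 map_mx0 !add0r; apply: BL.
Qed.

Lemma lag_top_sub_deligne : (B <= deligne_comp W F 0%R (- 0)%R)%VS.
Proof.
rewrite (deligne_comp_top WMK); apply/subvP => b bB.
have B0 : (B <= F 0%R)%VS by apply: lag_top_sub_hfil.
rewrite memv_cap; apply/andP; split; first exact: subvP B0 _ bB.
have [b' b'B [m mM e]] := lag_top_sub_conj LL bB.
rewrite e oppr0 add0r; apply: memv_add.
  by rewrite memv_conj conj_mxK; exact: subvP B0 _ b'B.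
rewrite memv_cap mM andbT memv_conj.
by apply: (subvP (weightM_sub_hfil _)); last exact: cM mM.
Qed.

(** This intersection is the piece A_p: the orthogonal complement of P (p + 1) inside P p. *)
Lemma pure_cap_sub_deligne p : ~~ odd `|p|%N ->
  (P p :&: D (p + 1)%R <= deligne_comp W F p (- p - 1)%R)%VS.
Proof.
move=> pe; rewrite (deligne_comp_pure WMK); apply/subvP => a.
have qE : p + 1 = - (- p - 1) by lia.
rewrite memv_cap => /andP[aP aD]; have aK := AK (PA aP).
rewrite !memv_cap aK !andbT; apply/andP; split.
  exact: subvP (piece_sub_hfil p) _ aP.
rewrite memv_conj; apply: (subvP (copiece_sub_hfil _)).
by rewrite -qE memv_conj conj_mxK.
Qed.

Let finite_deligne (Q : set int) (q : int -> int) :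
  (q = (fun p => - p - 1) \/ q = (fun p => - p)) ->
  finite_set (Q `&` (fun p => deligne_comp W F p (q p)) @^-1` [set~ 0%VS])%classic.
Proof.
move=> qE; have [N HN] := profile_bound prof.
have F0 p : N%:Z <= p -> 0 < p -> F p = 0%VS.
  move=> Np p0; apply/eqP; rewrite -dimv_eq0 dim_hfil.
  have := profile_dim prof p; have [-> e] := HN p Np.
  by rewrite ltNge (ltW p0) leNgt p0 /=; lia.
(* The radius is N + 1 because for negative p the index -p - 1 must also reach the range where F
   vanishes. *)
apply: sub_finite_set (finite_int_interval N.+1) => p /= [_ d0].
apply: contra_notT d0 => pN; apply/eqP; rewrite -subv0.
have [p0|p0] := lerP 0 p.
  rewrite -(F0 p); [|lia|lia].
  by rewrite /deligne_comp -capvA capvSl.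
case: qE => ->; first rewrite (deligne_comp_pure WMK) (F0 (- p - 1)); try lia.
  by rewrite conj_vspace0 cap0v capv0.
rewrite (deligne_comp_top WMK) (F0 (- p - 1)); try lia.
rewrite (F0 (- p)); try lia.
by rewrite conj_vspace0 cap0v addv0 capv0.
Qed.

Lemma even_part_hfil :
  (\big[addv/0%VS]_(r \in [set r : int | ~~ odd `|r|%N]%classic)
      deligne_comp W F r (- r - 1)%R +
   \big[addv/0%VS]_(r \in [set: int]%classic) deligne_comp W F r (- r)%R)%VS = L.
Proof.
apply/eqP; rewrite eqEsubv; apply/andP; split.
  rewrite subv_add; apply/andP; split; apply: fsbigv_sub => p.
    exact: deligne_pure_sub.
  by move=> _; apply: deligne_top_sub.
apply/subvP => l /(lag_decomp LL)[a aA [b bB ->]]; apply: memv_add; last first.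
  apply: (subvP (subv_trans lag_top_sub_deligne _)) bB.
  by apply: (fsbigv_sup (i := 0)) => //; apply: finite_deligne; right.
set S := (\big[_/_]_(_ \in _) _)%VS.
(* Descending along the flag: P p = P (p + 1) for odd p, and for even p the new part is P p :&: D (p
   + 1). The number k bounds the distance to the degrees where P vanishes. *)
have PS (k : nat) (p : int) : (forall q, p + k%:Z <= q -> P q = 0%VS) -> (P p <= S)%VS.
  elim: k p => [|k IH] p Pq; first by rewrite Pq ?sub0v // addr0.
  have IHp : (P (p + 1)%R <= S)%VS.
    by apply: IH => q pq; apply: Pq; lia.
  have [po|pe] := boolP (odd `|p|%N); first by rewrite pure_piece_odd.
  apply/subvP => v vP; have := PA vP; rewrite -(pure_pieceD (p + 1)).
  move=> /memv_addP[x xP [y yD e]]; rewrite e; apply: rpredD.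
    exact: (subvP IHp).
  have yP : y \in P p.
    have -> : y = v - x by rewrite e addrC addKr.
    by apply: rpredB => //; apply: subvP xP; apply: pure_piece_anti; lia.
  have : y \in (P p :&: D (p + 1)%R)%VS by rewrite memv_cap yP.
  apply: subvP; apply: subv_trans (pure_cap_sub_deligne pe) _.
  by apply: (fsbigv_sup (i := p)) => //; apply: finite_deligne; left.
have [N HN] := profile_bound prof.
have PA' : P (- N%:Z) = A.
  apply/eqP; rewrite eqEdim pure_piece_sub dim_pure_piece.
  have [_] := HN N%:Z (lexx _); have := dim_lag_pure LL.
  by rewrite -/A; lia.
have /subvP : (P (- N%:Z)%R <= S)%VS.
  apply: (PS (N + N)%N) => q Nq; apply/eqP; rewrite -dimv_eq0 dim_pure_piece.
  have Nq' : N%:Z <= q by lia.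
  by have [-> _] := HN q Nq'.
by rewrite PA'; apply.
Qed.

End EvenPart.
End HodgeFiltration.

(** * The lift of a point of Siegel space lies in D *)

Section PeriodPoint.
Local Open Scope ring_scope.
Variables (R : realType) (n : nat).
Local Notation C := R[i].
Local Notation V := 'cV[C]_(n + n).
Local Notation cj := (map_mx Num.conj).

Lemma complexi_exprz (p : int) :
  ('i%C : C) ^ (p + p + 1) = if odd `|p|%N then - 'i%C else 'i%C.
Proof.
have i0 := complexi_neq0 R.
have ii : ('i%C : C) * 'i%C = -1 by rewrite -expr2 sqr_i.
rewrite expfzDr // expfzDr // expr1z -expfzMl ii.
have -> : (-1 : C) ^ p = (-1) ^+ odd `|p|%N.
  case: p => k; first by rewrite -exprnP signr_odd.
  by rewrite NegzE -exprnN -exprVn invrN invr1 abszN signr_odd.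
by case: (odd _); rewrite ?expr0 ?expr1 ?mulN1r ?mul1r.
Qed.

Variables (M K L : {vspace V}) (h : int -> nat) (alpha : int -> nat).
Hypothesis LL : limit_lagrangian M K L.
Hypothesis prof : even_profile n h (\dim M) alpha.
Hypothesis fullL : (L + conj_vspace L)%VS = fullv.
Hypothesis posL : forall v, v \in L -> v != 0 -> 0 < hnorm v.
Let A := lag_pure K L.
Let B := lag_top M L.
Let P := pure_piece K L alpha.
Let D := pure_copiece K L alpha.
Let F := hfil M K L alpha.
#[local] Opaque pure_piece pure_copiece lag_pure lag_top hperp.

Let conjM : conj_vspace M = M.
Proof.
apply/vspaceP => v; rewrite memv_conj; apply/idP/idP => [vM|].
  by rewrite -[v]conj_mxK; apply: conj_weightM LL _ vM.
exact: conj_weightM LL v.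
Qed.

Lemma hfil_conj_full p : (F p + conj_vspace (F (- p)%R))%VS = fullv.
Proof.
set S := (_ + _)%VS; apply/eqP; rewrite eqEsubv subvf /=.
have FS : (F p <= S)%VS := addvSl _ _.
have cFS : (conj_vspace (F (- p)) <= S)%VS := addvSr _ _.
have AS : (A <= S)%VS.
  rewrite /A -(pure_pieceD alpha LL p) subv_add; apply/andP; split.
    exact: subv_trans (piece_sub_hfil _ _ _ _ _) FS.
  apply: subv_trans cFS; rewrite -conj_vspaceS conj_vspaceK.
  have := copiece_sub_hfil M K L alpha (- p); by rewrite opprK.
have cAS : (conj_vspace A <= S)%VS.
  rewrite /A -(pure_pieceD alpha LL (- p)) conj_vspaceD subv_add; apply/andP; split.
    apply: subv_trans cFS; rewrite conj_vspaceS; exact: piece_sub_hfil.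
  exact: subv_trans (copiece_sub_hfil _ _ _ _ _) FS.
(* For p = 0 neither F^0 nor its conjugate has M as a summand, and L + conj L = H_C is used instead.
   For other p one of p, -p is negative, so M is available and the splitting suffices. *)
have [p0|p0] := eqVneq p 0.
  have BF : (B <= F 0%R)%VS by apply: lag_top_sub_hfil.
  rewrite -fullL subv_add; apply/andP; split; apply/subvP => v.
    move=> /(lag_decomp LL)[a aA [b bB ->]]; apply: rpredD.
      exact: subvP AS _ aA.
    by apply: (subvP (subv_trans BF _)) bB; rewrite -p0.
  rewrite memv_conj => /(lag_decomp LL)[a aA [b bB e]].
  rewrite -[v]conj_mxK e conj_mxD; apply: rpredD.
    by apply: (subvP cAS); rewrite memv_conj conj_mxK.
  apply: (subvP cFS); rewrite memv_conj conj_mxK p0 oppr0.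
  exact: subvP BF _ bB.
have MS : (M <= S)%VS.
  have [pn|pp] := ltrP p 0; first exact: subv_trans (weightM_sub_hfil _ _ _ _ pn) FS.
  apply: subv_trans cFS; rewrite -{1}conjM conj_vspaceS; apply: weightM_sub_hfil.
  by rewrite oppr_lt0 lt_neqAle eq_sym p0.
have BS : (B <= S)%VS.
  have [pn|pp] := lerP p 0.
    by apply: subv_trans FS; apply: lag_top_sub_hfil.
  apply/subvP => _ /(lag_top_sub_conj LL)[b bB [m mM ->]].
  apply: rpredD; last exact: subvP MS _ mM.
  apply: (subvP cFS); rewrite memv_conj conj_mxK.
  apply: (subvP (lag_top_sub_hfil _ _ _ _ _)) bB.
  by rewrite oppr_le0 ltW.
by rewrite -(lag_split_full LL) !subv_add MS AS cAS BS.
Qed.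

Let conj_cap p q v : v \in F p -> v \in conj_vspace (F q) ->
  exists m a a' b,
  [/\ [/\ m \in M, 0 <= p -> m = 0 & 0 < q -> m = 0],
      a \in P p /\ a \in D (- q), a' \in D (- p) /\ a' \in P q,
      [/\ b \in B, 0 < p -> b = 0 & 0 < q -> b = 0] & v = m + a + cj a' + b].
Proof.
move=> vF vcF; have := hfil_conj_cap LL vF vcF (mem0v M) (esym (addr0 v)).
by [].
Qed.

(** The splitting leaves only vectors of B, and only for p = 0. Such a vector has its conjugate in B
    too, so it is null for the form, which is positive on L. *)
Lemma hfil_conj_cap0 p : (F p :&: conj_vspace (F (- p)%R))%VS = 0%VS.
Proof.
apply/eqP; rewrite -subv0; apply/subvP => v; rewrite memv_cap memv0.
have cap q w : w \in F q -> w \in conj_vspace (F (- q)) -> w \in B /\ (q != 0 -> w = 0).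
  move=> wF wcF.
  have [m [a [a' [b [[mM m0 m0'] [aP aD] [a'D a'P] [bB b0 b0'] e]]]]] := conj_cap wF wcF.
  rewrite opprK in aD.
  have ea := pure_piece_copiece LL aP aD; have ea' := pure_piece_copiece LL a'P a'D.
  have em : m = 0.
    by have [q0|q0] := lerP 0 q; [exact: m0 | apply: m0'; rewrite oppr_gt0].
  have ew : w = b by rewrite e em ea ea' map_mx0 !add0r.
  split=> [|q0]; rewrite ew //; have [qn|qp] := ltrP q 0.
    by apply: b0'; rewrite oppr_gt0.
  by apply: b0; rewrite lt_neqAle eq_sym q0.
move=> /andP[vF vcF]; have [vB v0] := cap _ _ vF vcF.
have [p0|p0] := eqVneq p 0; last by rewrite v0.
rewrite p0 oppr0 in vF vcF.
have [cvB _] : cj v \in B /\ (0 != 0 :> int -> cj v = 0).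
  by apply: cap; rewrite ?oppr0 ?memv_conj ?conj_mxK // -memv_conj.
apply/negPn/negP => /(posL (lag_top_lag vB)).
by rewrite /hnorm (lagrangian_isotropic LL (lag_top_lag vB) (lag_top_lag cvB)) mulr0 ltxx.
Qed.

(** For odd p only a component conj a' remains, where the form is negative and the sign i^{p-q}
    reverses it. For even p the vector is a + b, in L. *)
Let positive_ge0 p q v : p + q = -1 -> 0 <= p ->
  v \in F p -> v \in conj_vspace (F q) -> v != 0 ->
  0 < ('i%C : C) ^ (p - q) * Qform v (cj v).
Proof.
move=> pq p0 vF vcF vN0.
have -> : p - q = p + p + 1 by lia.
rewrite complexi_exprz.
have eq : - q = p + 1 by lia.
have eodd : odd `|q|%N = ~~ odd `|p|%N by lia.
have ep : p != 0 -> 0 < p by lia.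
have eNp : - p = q + 1 by lia.
have [m [a [a' [b [[mM m0 _] [aP aD] [a'D a'P] [bB b0 _] e]]]]] := conj_cap vF vcF.
rewrite (m0 p0) add0r in e.
case: ifPn => po.
  have pp : 0 < p by apply: ep; apply/eqP => p00; rewrite p00 in po.
  have ea : a = 0.
    apply: (pure_piece_copiece LL aP).
    by move: aD; rewrite eq /D (pure_copiece_odd K L prof po).
  have ev : v = cj a' by rewrite e ea (b0 pp) add0r addr0.
  have a'L : a' \in L by apply: lag_pure_lag (subvP (pure_piece_sub _ _ _ _) _ a'P).
  have a'N0 : a' != 0 by rewrite -conj_mx_eq0 -ev.
  by rewrite mulNr -/(hnorm v) ev hnorm_conj opprK; apply: posL.
have ea' : a' = 0.
  apply: (pure_piece_copiece LL a'P).
  by move: a'D; rewrite eNp /D -(pure_copiece_odd K L prof) // eodd.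
rewrite -/(hnorm v); apply: posL => //; rewrite e ea' map_mx0 addr0.
apply: rpredD; last exact: lag_top_lag bB.
exact: lag_pure_lag (subvP (pure_piece_sub _ _ _ _) _ aP).
Qed.

Lemma period_domain_hfil : period_domain R h F.
Proof.
split; first exact: compact_dual_hfil LL prof.
  by move=> p; split; [exact: hfil_conj_full | exact: hfil_conj_cap0].
move=> p q v pq; rewrite memv_cap => /andP[vF vcF] vN0.
have [p0|p0] := lerP 0 p; first exact: (positive_ge0 pq).
have q0 : 0 <= q by lia.
have pq' : q + p = -1 by lia.
(* Passing to conj v exchanges p and q; both i^{p-q} and Q(v, conj v) change sign. *)
have := @positive_ge0 q p (cj v) pq' q0.
rewrite memv_conj conj_mxK -memv_conj conj_mx_eq0 => /(_ vcF vF vN0).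
have -> : p - q = p + p + 1 by lia.
have -> : q - p = q + q + 1 by lia.
rewrite !complexi_exprz QformC mulrN -mulNr.
have -> : odd `|p|%N = ~~ odd `|q|%N by lia.
by case: (odd _); rewrite ?opprK.
Qed.

End PeriodPoint.

(** * Compatibility of the lift with exp(X) = 1 + X *)

Section WeightShift.
Local Open Scope ring_scope.
Variables (R : realType) (n : nat).
Local Notation C := R[i].
Local Notation V := 'cV[C]_(n + n).
Local Notation cj := (map_mx Num.conj).
Variables (M K L : {vspace V}) (X : 'M[C]_(n + n)) (alpha : int -> nat).
Hypothesis LL : limit_lagrangian M K L.
Hypothesis spX : in_sp X.
Hypothesis XM : forall v, X *m v \in M.
Hypothesis XK : forall v, v \in K -> X *m v = 0.
Let T : 'End(V) := mxop (1%:M + X).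

Lemma shiftE v : T v = v + X *m v.
Proof. by rewrite /T lfunE /= mulmxDl mul1mx. Qed.

Let MK v : v \in M -> v \in K. Proof. exact: (subvP (weight_sub LL)). Qed.

Lemma shift_weight v : (T v \in K) = (v \in K).
Proof.
rewrite shiftE; apply/idP/idP => vK.
  by rewrite -(addrK (X *m v) v) rpredB // MK.
by rewrite rpredD // MK.
Qed.

Lemma shift_id v : v \in K -> T v = v.
Proof. by move=> vK; rewrite shiftE XK // addr0. Qed.

Lemma shift_img_id (U : {vspace V}) : (U <= K)%VS -> (T @: U)%VS = U.
Proof.
move=> /subvP UK; apply/vspaceP => v; apply/memv_imgP/idP => [[u uU ->]|vU].
  by rewrite shift_id // UK.
by exists v => //; rewrite shift_id // UK.
Qed.

Lemma dim_shift (U : {vspace V}) : \dim (T @: U) = \dim U.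
Proof.
apply: limg_dim_eq; apply/eqP; rewrite -subv0; apply/subvP => v.
rewrite memv_cap memv_ker memv0 => /andP[_ /eqP v0].
have vK : v \in K by rewrite -shift_weight v0 mem0v.
by rewrite -(shift_id vK) v0.
Qed.

Lemma Qform_shift u v : Qform (T u) (T v) = Qform u v.
Proof.
rewrite !shiftE !QformDl !QformDr (Qform_sp _ _ spX).
rewrite (weight_orth LL (XM u) (MK (XM v))) addr0.
by rewrite addrK.
Qed.

(** T is the identity on K and respects membership in K. Equality of subspaces also gives equality
    of their [vbasis], so the flags for L and for its translate coincide. *)
Lemma shift_pure : lag_pure K (T @: L) = lag_pure K L.
Proof.
apply/vspaceP => v; rewrite !memv_cap; apply/andP/andP => -[vL vK]; split=> //.
  by case/memv_imgP: vL vK => u uL ->; rewrite shift_weight => uK; rewrite shift_id.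
by rewrite -(shift_id vK) memv_img.
Qed.

Lemma limit_lagrangian_shift : limit_lagrangian M K (T @: L).
Proof.
split; try by case: LL.
- move=> _ _ /memv_imgP[u uL ->] /memv_imgP[w wL ->].
  by rewrite Qform_shift; apply: lagrangian_isotropic LL _ _ uL wL.
- by rewrite dim_shift; exact: dim_lagrangian LL.
move=> v vL vK; have : v \in lag_pure K (T @: L) by rewrite memv_cap vL.
by rewrite shift_pure; exact: lag_pure_pos LL v.
Qed.

Lemma shift_conj_weightM : (conj_vspace (T @: L) + M)%VS = (conj_vspace L + M)%VS.
Proof.
apply/vspaceP => v; apply/memv_addP/memv_addP => -[l]; rewrite memv_conj.
  move=> /memv_imgP[u uL e] [m mM ->].
  exists (cj u); first by rewrite memv_conj conj_mxK.
  exists (cj (X *m u) + m); first by rewrite rpredD // (conj_weightM LL).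
  by rewrite -[l]conj_mxK e shiftE conj_mxD addrA.
move=> lL [m mM ->]; exists (cj (T (cj l))).
  by rewrite memv_conj conj_mxK memv_img.
exists (m - cj (X *m cj l)); first by rewrite rpredB // (conj_weightM LL).
by rewrite shiftE conj_mxD conj_mxK addrACA subrr addr0.
Qed.

Lemma shift_top : lag_top M (T @: L) = (T @: lag_top M L)%VS.
Proof.
rewrite /lag_top shift_conj_weightM; apply/vspaceP => v; rewrite memv_cap.
apply/andP/memv_imgP => [[/memv_imgP[u uL ->] vS]|[u + ->]].
  exists u => //; rewrite memv_cap uL /=.
  rewrite -(addrK (X *m u) u) rpredB -?shiftE //.
  by apply: (subvP (addvSr _ _)).
rewrite memv_cap => /andP[uL uS]; split; first exact: memv_img.
by rewrite shiftE rpredD //; apply: (subvP (addvSr _ _)).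
Qed.

(** All summands except B lie in K, where T is the identity; B is carried along because conj L + M
    does not change. *)
Lemma hfil_shift p : hfil M K (T @: L) alpha p = (T @: hfil M K L alpha p)%VS.
Proof.
have PE q : pure_piece K (T @: L) alpha q = pure_piece K L alpha q.
  by rewrite /pure_piece shift_pure.
have PK q : (pure_piece K L alpha q <= K)%VS.
  exact: subv_trans (pure_piece_sub _ _ _ _) (capvSr _ _).
rewrite /hfil /pure_copiece !PE shift_pure shift_top !limgD; congr (_ + _ + _ + _)%VS.
- by rewrite shift_img_id //; case: ifP => _; rewrite ?sub0v ?(weight_sub LL).
- by rewrite shift_img_id.
- rewrite shift_img_id //; apply/subvP => v; rewrite memv_conj memv_cap => /andP[vA _].
  rewrite -[v]conj_mxK; apply: (conj_weightK LL); exact: lag_pure_weight vA.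
by case: ifP => _; rewrite ?limg0.
Qed.

End WeightShift.

(** * Dimensions of the even pieces *)

Section TailSums.
Local Open Scope classical_set_scope.
Local Open Scope ring_scope.
Implicit Types (f : int -> nat) (p q : int).

Definition tail_sum f p : nat := \big[addn/0%N]_(s \in [set s : int | p <= s]) f s.

Lemma bounded_support f : finite_set [set p | f p <> 0%N] ->
  exists N : nat, forall p, (N <= `|p|)%N -> f p = 0%N.
Proof.
move=> /finite_seqP[s sE].
exists (\max_(p <- s) `|p|%N).+1 => p Np; apply: contrapT => fp.
have : [set` s] p by rewrite -sE.
move=> /= ps; have := @leq_bigmax_seq _ _ xpredT (fun q : int => `|q|%N) _ ps isT.
by rewrite leqNgt Np.
Qed.

Lemma tail_sum_step f p : finite_set [set p | f p <> 0%N] ->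
  tail_sum f p = (f p + tail_sum f (p + 1))%N.
Proof.
move=> fin; rewrite /tail_sum fsbig_supp [in RHS]fsbig_supp.
have fin' (Q : set int) : finite_set (Q `&` f @^-1` [set~ 0%N]).
  by apply: sub_finite_set fin => s /= [].
have e0 : [set s | p + 1 <= s] `&` f @^-1` [set~ 0%N] =
          ([set s | p <= s] `&` f @^-1` [set~ 0%N]) `\ p.
  apply/seteqP; split=> s /=; first by move=> [ps fs]; split; [split=> //|]; lia.
  by move=> [[ps fs] sp]; split=> //; lia.
rewrite e0; have [fp0|fp0] := eqVneq (f p) 0%N.
  rewrite fp0 add0n; congr (\big[_/_]_(_ \in _) _).
  by apply/seteqP; split=> s /=; [move=> [ps fs]; split=> // sp; rewrite sp in fs | case].
by rewrite (fsbigD1 p) //=; split=> //; apply/eqP.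
Qed.

Lemma tail_sum_eq0 f (N : nat) p : (forall s, (N <= `|s|)%N -> f s = 0%N) ->
  N%:Z <= p -> tail_sum f p = 0%N.
Proof. by move=> fN Np; apply: fsbig1 => s /= ps; apply: fN; lia. Qed.

Lemma tail_sum_total f (N : nat) p : (forall s, (N <= `|s|)%N -> f s = 0%N) ->
  p <= - N%:Z -> tail_sum f p = \big[addn/0%N]_(s \in [set: int]) f s.
Proof.
move=> fN Np; apply: fsbig_widen => // s [_ /= ps].
by apply: fN; move/negP: ps; lia.
Qed.

Lemma tail_sum_anti f p q : finite_set [set p | f p <> 0%N] -> p <= q ->
  (tail_sum f q <= tail_sum f p)%N.
Proof.
move=> fin pq; have -> : q = p + `|q - p|%N%:Z by lia.
elim: `|q - p|%N => [|k IH]; first by rewrite addr0.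
apply: leq_trans IH; rewrite (tail_sum_step (p + k%:Z) fin).
have -> : p + k.+1%:Z = p + k%:Z + 1 by lia.
exact: leq_addl.
Qed.

Variables (n : nat) (h : int -> nat) (r : nat).
Hypothesis hnum : hodge_numbers n h.
Hypothesis rh : (r <= h 0)%N.

(** The Hodge numbers of the even part. *)
Let g p : nat := if odd `|p|%N then 0%N else h p.

Let hfin : finite_set [set p | h p <> 0%N]. Proof. by case: hnum. Qed.
Let gfin : finite_set [set p | g p <> 0%N].
Proof. by apply: sub_finite_set hfin => p /=; rewrite /g; case: ifP. Qed.

(** The symmetry p <-> -p - 1 exchanges parities, so the odd degrees >= p count the same as the even
    degrees < -p. This is the last relation, proved by descending induction with the even total t in
    place of n; evaluated far to the left it gives 2n = 2t. *)
Let even_tail : exists N : nat, [/\ forall p, N%:Z <= p -> tail_sum g p = 0%N,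
  forall p, p <= - N%:Z -> tail_sum g p = n &
  forall p, (tail_sum h p + tail_sum g (- p) = tail_sum g p + n)%N].
Proof.
have [N hN] := bounded_support hfin.
have gN s : (N <= `|s|)%N -> g s = 0%N by move=> /hN; rewrite /g; case: ifP.
pose t := (\big[addn/0%N]_(s \in [set: int]) g s)%N.
have low p : p <= - N%:Z -> tail_sum g p = t by move=> pN; apply: (tail_sum_total gN).
have rel (k : nat) p : N%:Z <= p + k%:Z ->
    (tail_sum h p + tail_sum g (- p) = tail_sum g p + t)%N.
  elim: k p => [|k IH] p pk.
    have Np : N%:Z <= p by lia.
    by rewrite (tail_sum_eq0 hN Np) (tail_sum_eq0 gN Np) low // lerN2.
  have := IH (p + 1); rewrite (tail_sum_step p hfin) (tail_sum_step p gfin).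
  have := tail_sum_step (- p - 1) gfin; rewrite subrK opprD => ->.
  have -> : g (- p - 1) = if odd `|p|%N then h p else 0%N.
    have [hs _ _] := hnum; rewrite /g hs.
    by have -> : odd `|- p - 1|%N = ~~ odd `|p|%N; [lia | case: (odd _)].
  rewrite /g; case: ifP => _ IH'; have := IH' ltac:(lia); lia.
have tn : t = n.
  have [_ _ tot] := hnum.
  have := rel (N + N)%N (- N%:Z) ltac:(lia).
  rewrite opprK (tail_sum_total hN) // tot (tail_sum_eq0 gN) // low //; lia.
by exists N; split=> [p|p /low|p]; rewrite -?tn //;
  [exact: tail_sum_eq0 | apply: (rel (N + `|p|)%N); lia].
Qed.

Lemma even_profile_exists : exists alpha, even_profile n h r alpha.
Proof.
have [N [high low rel]] := even_tail.
(* I^{-1,-1} = M and I^{0,0} = B contribute to h^{-1,0} and h^{0,-1}, so r is removed from degree 0,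
   that is, from every tail with p <= 0. The bound r <= h 0 keeps the flag decreasing between 0 and
   1 and the subtraction untruncated. *)
exists (fun p => tail_sum g p - (if (p <= 0)%R then r else 0))%N.
have le p : (tail_sum g p <= n)%N.
  have [pN|pN] := lerP p (- N%:Z); first by rewrite low.
  by rewrite -(low (- N%:Z)) //; apply: tail_sum_anti gfin _; exact: ltW.
have step0 : (tail_sum g 1 + r <= tail_sum g 0)%N.
  by rewrite (tail_sum_step 0 gfin) add0r addnC leq_add2r.
have pos p : 0 < p -> (tail_sum g p <= tail_sum g 1)%N.
  by move=> p0; apply: tail_sum_anti gfin _; lia.
have neg p : p <= 0 -> (tail_sum g 0 <= tail_sum g p)%N.
  by move=> p0; apply: tail_sum_anti gfin _; lia.
split.
- move=> p; have := le p; have := le 0; have [p0|p0] := lerP p 0.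
    by have := neg p p0; lia.
  by have := pos p p0; lia.
- move=> p; have pp : p <= p + 1 by lia.
  have := tail_sum_anti gfin pp.
  have [p1|p1] := lerP (p + 1) 0; have [p0|p0] := lerP p 0; try lia.
  have p00 : p = 0 by lia.
  by move: step0; rewrite p00 add0r; lia.
- move=> p podd; rewrite (tail_sum_step p gfin) /g podd add0n.
  by have -> : (p <= 0) = (p + 1 <= 0) by lia.
- move=> p; rewrite -/(tail_sum h p); have := rel p; have := neg p; have := neg (- p).
  by case: (ltrgtP p 0) => p0 np pp; case: ifP => np0; lia.
exists (maxn N 1) => p Np; rewrite high ?low; try lia.
have := le 0; have -> : (- p <= 0) by lia.
by lia.
Qed.

End TailSums.

(** * Positivity and the cone *)

Section PositiveForms.
Local Open Scope ring_scope.
Variables (R : realType) (n : nat).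
Local Notation C := R[i].
Local Notation V := 'cV[C]_(n + n).
Local Notation cj := (map_mx Num.conj).
Implicit Types (u v w : V).

Lemma conjC_real (t : R) : ((t%:C)%C : C)^* = (t%:C)%C.
Proof. by apply/eqP; rewrite eq_complex /= oppr0 !eqxx. Qed.

(** In the order of [C], 0 <= z includes that z is real: t = 1 and t = 2 make s real, and a negative
    s is refuted at a large t. *)
Lemma ge0_slope (a s : C) :
  (forall t : R, 1 <= t -> 0 <= a + (t%:C)%C * s) -> 0 <= s.
Proof.
case: a s => [a1 a2] [s1 s2] H.
have H' t : 1 <= t -> (a2 + t * s2 = 0) /\ 0 <= a1 + t * s1.
  move=> /H; rewrite lecE /= !mul0r subr0 addr0 => /andP[/eqP e1 e2].
  by split.
have [h1 _] := H' 1 (lexx _); have [h2 _] := H' 2 ltac:(lra).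
rewrite lecE /=; apply/andP; split; first by apply/eqP; lra.
rewrite leNgt; apply/negP => s0.
have s0' : 0 < - s1 by lra.
have t1 : 1 <= 1 + `|a1| / - s1 by rewrite lerDl divr_ge0 // ltW.
have [_] := H' _ t1; rewrite mulrDl mul1r -mulrA invrN mulNr mulVf ?lt_eqF // mulrN1.
by have := ler_norm a1; lra.
Qed.

Section RealNilpotent.
Variable N : 'M[C]_(n + n).
Hypothesis realN : cj N = N.
Hypothesis spN : in_sp N.

Definition nilp_form (v w : V) : C := - Qform (N *m v) (cj w).

Lemma conj_mulmx v : cj (N *m v) = N *m cj v.
Proof. by rewrite map_mxM realN. Qed.

Lemma nilp_formC v w : nilp_form w v = (nilp_form v w)^*.
Proof.
rewrite /nilp_form rmorphN /= -Qform_conj conj_mulmx conj_mxK.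
by rewrite (Qform_sp _ _ spN) (QformC w) opprK.
Qed.

(** A null vector of a semidefinite Hermitian form lies in its radical, which is Ker N by
    nondegeneracy of Q. Along u - t conj(d) v, with d the pairing of v and u, the form is affine in
    t of slope -2 |d|^2, so d = 0. *)
Lemma nilp_form_ker v : (forall w, 0 <= nilp_form w w) ->
  nilp_form v v = 0 -> N *m v = 0.
Proof.
move=> psd v0; apply: Qform_nondeg => w; rewrite -[w]conj_mxK.
set u := cj w; set d := nilp_form v u.
have : 0 <= - (d * d^* + d * d^*).
  apply: (@ge0_slope (nilp_form u u)) => t _.
  have := psd (u - ((t%:C)%C * d^*) *: v).
  have -> : nilp_form (u - ((t%:C)%C * d^*) *: v) (u - ((t%:C)%C * d^*) *: v) =
    nilp_form u u + (t%:C)%C * - (d * d^* + d * d^*)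
    + (t%:C)%C * (t%:C)%C * d^* * d * nilp_form v v.
    rewrite /nilp_form mulmxBr -scalemxAr map_mxB conj_mxZ.
    rewrite !(QformDl, QformDr, QformNl, QformNr, QformZl, QformZr).
    have := nilp_formC v u; rewrite -/d /nilp_form => /(congr1 -%R).
    rewrite opprK => ->; rewrite rmorphM /= conjCK.
    rewrite conjC_real.
    have -> : Qform (N *m v) (cj u) = - d by rewrite opprK.
    by ring.
  by rewrite v0 mulr0 addr0.
rewrite oppr_ge0 -mulr2n pmulrn_lle0 // -normCK => d0.
have : `|d| ^+ 2 == 0 by rewrite eq_le d0 exprn_ge0.
by rewrite expf_eq0 normr_eq0 /d /nilp_form oppr_eq0 => /eqP.
Qed.

Hypothesis NN : N *m N = 0.

Let K : {vspace V} := lker (mxop N).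
Let M : {vspace V} := limg (mxop N).

(** Thus the image is determined by the kernel, and independence of N need only be shown for
    kernels. *)
Lemma limg_hperp_lker : M = hperp K.
Proof.
have dimV := dim_cVf R (n + n).
apply/eqP; rewrite eqEdim; apply/andP; split.
  apply/subvP => _ /memv_imgP[v _ ->]; apply/memv_hperp => k.
  rewrite !lfunE /= memv_ker lfunE /= => /eqP k0.
  by rewrite (Qform_sp _ _ spN) -conj_mulmx k0 map_mx0 Qform0r oppr0.
have h1 := limg_ker_dim (mxop N) fullv; rewrite capfv dimV in h1.
by rewrite -(leq_add2r (\dim K)) dim_hperp [leqRHS]addnC h1.
Qed.

Lemma limit_lagrangian_nilp (L : {vspace V}) :
  (forall v w, v \in L -> w \in L -> Qform v w = 0) -> \dim L = n ->
  (forall v, v \in L -> N *m v = 0 -> v != 0 -> 0 < hnorm v) ->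
  limit_lagrangian M K L.
Proof.
move=> iso dimL pos.
have dimV := dim_cVf R (n + n).
have KP v : (v \in K) = (N *m v == 0) by rewrite memv_ker lfunE.
split=> //.
- move=> _ /memv_imgP[v _ ->]; rewrite lfunE /= conj_mulmx.
  by apply/memv_imgP; exists (cj v); rewrite ?memvf ?lfunE.
- by move=> v; rewrite !KP -conj_mulmx => /eqP ->; rewrite map_mx0.
- by apply/subvP => _ /memv_imgP[v _ ->]; rewrite KP lfunE /= mulmxA NN mul0mx.
- move=> _ w /memv_imgP[v _ ->]; rewrite KP lfunE /= => /eqP w0.
  by rewrite (Qform_sp _ _ spN) w0 Qform0r oppr0.
- have := limg_ker_dim (mxop N) fullv.
  by rewrite capfv dimV addnC.
- by move=> v vL; rewrite KP => /eqP; apply: pos.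
Qed.

(* On L the hermitian form of exp(i t N) L is affine in t with slope
   [2 * nilp_form], which gives positivity on L + ker N = H_C. *)
Lemma nilp_form_ge0 (L : {vspace V}) :
  (forall v w, v \in L -> w \in L -> Qform v w = 0) -> \dim L = n ->
  (forall (t : R) v, 1 <= t -> v \in L ->
     v + ('i%C * (t%:C)%C) *: (N *m v) != 0 ->
     0 < hnorm (v + ('i%C * (t%:C)%C) *: (N *m v))) ->
  forall v, 0 <= nilp_form v v.
Proof.
move=> iso dimL pos.
have LL : limit_lagrangian M K L.
  apply: limit_lagrangian_nilp => // v vL v0 vN0.
  by have := pos 1 v (lexx _) vL; rewrite v0 scaler0 addr0; apply.
have psdL v : v \in L -> 0 <= nilp_form v v.
  move=> vL; have [->|vN0] := eqVneq v 0; first by rewrite /nilp_form mulmx0 Qform0l oppr0.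
  suff : 0 <= nilp_form v v + nilp_form v v.
    by rewrite -mulr2n pmulrn_lge0.
  apply: (@ge0_slope (hnorm v)) => t t1.
  have TN0 : v + ('i%C * (t%:C)%C) *: (N *m v) != 0.
    apply: contraNneq vN0 => e; have := congr1 (mulmx N) e.
    rewrite mulmxDr -scalemxAr mulmxA NN mul0mx scaler0 addr0 mulmx0 => v0.
    by move: e; rewrite v0 scaler0 addr0 => ->.
  have := ltW (pos t v t1 vL TN0); congr (_ <= _).
  rewrite /hnorm /nilp_form conj_mxD conj_mxZ conj_mulmx.
  rewrite !(QformDl, QformDr, QformZl, QformZr).
  rewrite -[Qform v (N *m _)]opprK -(Qform_sp _ _ spN).
  have -> : Qform (N *m v) (N *m cj v) = 0.
    by rewrite (Qform_sp _ _ spN) mulmxA NN mul0mx Qform0r oppr0.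
  rewrite rmorphM /= conj_complexi.
  rewrite conjC_real.
  have ii : ('i%C : C) * 'i%C = -1 by rewrite -expr2 sqr_i.
  set q := Qform v _; set s := Qform (N *m v) _; set T := (t%:C)%C.
  have -> : 'i%C * (q + - 'i%C * T * - s + 'i%C * T * (s + - 'i%C * T * 0)) =
    'i%C * q + ('i%C * 'i%C) * T * s + ('i%C * 'i%C) * T * s by ring.
  by rewrite ii; ring.
move=> v; have [m [a [a' [b [mM aA a'A bB ->]]]]] := lag_splitP LL v.
have kK : m + a + cj a' \in K.
  apply: rpredD; last by apply: (conj_weightK LL); exact: lag_pure_weight a'A.
  by apply: rpredD; [apply: (subvP (weight_sub LL)) | exact: lag_pure_weight aA].
have : N *m (m + a + cj a') = 0 by move: kK; rewrite memv_ker lfunE => /eqP.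
move: (m + a + cj a') => k k0; rewrite /nilp_form mulmxDr k0 add0r conj_mxD QformDr.
rewrite (Qform_sp _ (cj k) spN) -conj_mulmx k0 map_mx0 Qform0r oppr0 add0r.
exact: psdL (lag_top_lag bB).
Qed.

End RealNilpotent.
End PositiveForms.

(** * Common kernel and image of positive combinations of the N_j *)

Section GeneratorCombinations.
Local Open Scope classical_set_scope.
Local Open Scope ring_scope.
Variables (R : realType) (n : nat) (sigma : nilpotent_cone n).
Local Notation C := R[i].
Local Notation V := 'cV[C]_(n + n).
Local Notation cj := (map_mx Num.conj).
Local Notation I := 'I_(cone_size sigma).
Implicit Types (u v w : V).

Lemma mulmx_lker_mxop (X : 'M[C]_(n + n)) v : v \in lker (mxop X) -> X *m v = 0.
Proof. by rewrite memv_ker lfunE => /eqP. Qed.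

Lemma memv_lker_mxop (X : 'M[C]_(n + n)) v : X *m v = 0 -> v \in lker (mxop X).
Proof. by move=> v0; rewrite memv_ker lfunE /= v0. Qed.

Lemma gen_combD (F : fieldType) (x y : I -> F) :
  gen_comb (fun j => x j + y j) = gen_comb x + gen_comb y.
Proof. by rewrite /gen_comb -big_split; apply: eq_bigr => j _; rewrite scalerDl. Qed.

Lemma gen_combZ (F : fieldType) (a : F) (x : I -> F) :
  gen_comb (fun j => a * x j) = a *: gen_comb x.
Proof. by rewrite /gen_comb scaler_sumr; apply: eq_bigr => j _; rewrite scalerA. Qed.

Lemma gen_combN (F : fieldType) (x : I -> F) :
  gen_comb (fun j => - x j) = - gen_comb x.
Proof. by rewrite /gen_comb -sumrN; apply: eq_bigr => j _; rewrite scaleNr. Qed.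

Definition gen_at (F : fieldType) (j : I) : 'M[F]_(n + n) := map_mx ratr (cone_gen j).

Lemma gen_comb_delta (F : fieldType) (j : I) :
  gen_comb (fun k => (k == j)%:R : F) = gen_at F j.
Proof.
rewrite /gen_comb (bigD1 j) //= eqxx scale1r big1 ?addr0 // => k kj.
by rewrite (negbTE kj) scale0r.
Qed.

Lemma cplx_gen_comb (x : I -> R) :
  cplx_mx (gen_comb x) = gen_comb (fun j => (x j)%:C%C) :> 'M[C]_(n + n).
Proof.
rewrite /cplx_mx /gen_comb raddf_sum; apply: eq_bigr => j _ /=.
by rewrite map_mxZ; congr (_ *: _); apply/matrixP => a b; rewrite !mxE fmorph_rat.
Qed.

Lemma conj_gen_comb (c : I -> C) : cj (gen_comb c) = gen_comb (fun j => (c j)^*).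
Proof.
rewrite /gen_comb raddf_sum; apply: eq_bigr => j _ /=.
by rewrite map_mxZ; congr (_ *: _); apply/matrixP => a b; rewrite !mxE fmorph_rat.
Qed.

Lemma gen_comb_sp (c : I -> C) : in_sp (gen_comb c).
Proof.
rewrite /in_sp /gen_comb raddf_sum mulmx_suml mulmx_sumr -big_split big1 //= => j _.
have eS : symp_mx C n = map_mx ratr (symp_mx rat n).
  by rewrite /symp_mx map_block_mx !map_mx0 map_mxN map_mx1.
rewrite linearZ /= -scalemxAl -scalemxAr -scalerDr eS map_trmx -!map_mxM -map_mxD.
by rewrite cone_gen_sp map_mx0 scaler0.
Qed.

Hypothesis sq0 : forall N : 'M[R]_(n + n), cone R sigma N -> N ^+ 2 = 0.

(** Polarization of the square: N_j, N_k and N_j + N_k have square zero and commute, so 2 N_j N_k =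
    0. *)
Lemma gen_mul0 (j k : I) : cone_gen j *m cone_gen k = 0.
Proof.
have inj (A : 'M[rat]_(n + n)) : map_mx (ratr : rat -> R) A = 0 -> A = 0.
  by move=> /eqP; rewrite map_mx_eq0 => /eqP.
have sq (x : I -> R) : (forall l, 0 <= x l) -> gen_comb x *m gen_comb x = 0.
  by move=> x0; rewrite -[RHS](sq0 (N := gen_comb x)) // ; exists x.
have gg (l : I) : cone_gen l *m cone_gen l = 0.
  apply: (inj (cone_gen l *m cone_gen l)); rewrite map_mxM -/(gen_at R l) -gen_comb_delta.
  by apply: sq => m; apply: ler0n.
have := sq (fun l => (l == j)%:R + (l == k)%:R) (fun l => addr_ge0 (ler0n _ _) (ler0n _ _)).
rewrite gen_combD !gen_comb_delta /gen_at -map_mxD -map_mxM => /inj.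
rewrite mulmxDl !mulmxDr !gg add0r addr0 [cone_gen k *m _]cone_gen_comm -mulr2n.
by move=> /eqP; rewrite -scaler_nat scaler_eq0 => /orP[//|/eqP].
Qed.

Lemma gen_comb_mul0 (c d : I -> C) : gen_comb c *m gen_comb d = 0.
Proof.
rewrite /gen_comb mulmx_suml big1 // => j _; rewrite mulmx_sumr big1 // => k _.
by rewrite -scalemxAl -scalemxAr -map_mxM gen_mul0 map_mx0 !scaler0.
Qed.

Lemma nilexp_gen_comb (c : I -> C) : nilexp (gen_comb c) = 1%:M + gen_comb c.
Proof.
have X2 : gen_comb c ^+ 2 = 0 by rewrite expr2; exact: gen_comb_mul0.
move: (gen_comb c) X2 => X X2; rewrite /nilexp.
rewrite -(big_mkord xpredT (fun k => (k`!%:R)^-1 *: X ^+ k)).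
(* For n = 0 the sum has no linear term, but matrices then have no entries. *)
have [n0|n0] := posnP (n + n).
  by apply/matrixP => i; have := ltn_ord i; rewrite {2}n0.
rewrite big_ltn // big_ltn // big1_seq ?addr0.
  by rewrite fact0 invr1 !scale1r.
move=> k /= /[!mem_index_iota] /andP[k2 _].
by rewrite -(subnK k2) exprD X2 mulr0 scaler0.
Qed.

Hypothesis psd : forall (j : I) v, 0 <= nilp_form (gen_at C j) v v.

Let gen_at_real (j : I) : cj (gen_at C j) = gen_at C j.
Proof. by apply/matrixP => a b; rewrite !mxE fmorph_rat. Qed.

Let gen_at_sp (j : I) : in_sp (gen_at C j).
Proof. by rewrite -gen_comb_delta; apply: gen_comb_sp. Qed.

(** A positive combination of semidefinite forms vanishes at v only if each of them does, and
    [nilp_form_ker] turns this into N_j v = 0. *)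
Lemma ker_gen_comb (x : I -> R) v : (forall j, 0 < x j) ->
  gen_comb (fun j => (x j)%:C%C) *m v = 0 -> forall j, gen_at C j *m v = 0.
Proof.
move=> x0 xv j; apply: nilp_form_ker => //.
have x0' k : 0 < (x k)%:C%C :> C by rewrite ltcR.
have : \sum_k (x k)%:C%C * nilp_form (gen_at C k) v v = 0.
  transitivity (- Qform (gen_comb (fun j => (x j)%:C%C) *m v) (cj v)).
    rewrite /gen_comb mulmx_suml Qform_suml -sumrN; apply: eq_bigr => k _.
    by rewrite -scalemxAl QformZl mulrN.
  by rewrite xv Qform0l oppr0.
move/eqP; rewrite psumr_eq0 => [/allP/(_ j)|k _].
  by rewrite mem_index_enum mulf_eq0 gt_eqF //= => /(_ isT)/eqP.
by rewrite mulr_ge0 // ltW.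
Qed.

Definition cone_sum : 'M[C]_(n + n) := gen_comb (fun _ : I => 1).
Definition cone_ker : {vspace V} := lker (mxop cone_sum).
Definition cone_img : {vspace V} := limg (mxop cone_sum).

Let cone_sumE : cone_sum = gen_comb (fun j : I => (1 : R)%:C%C).
Proof. by []. Qed.

Lemma cone_ker_gen v (c : I -> C) : v \in cone_ker -> gen_comb c *m v = 0.
Proof.
move=> /mulmx_lker_mxop; rewrite cone_sumE => /ker_gen_comb v0.
rewrite /gen_comb mulmx_suml big1 // => j _.
by rewrite -scalemxAl v0 ?scaler0 // => k; apply: ltr01.
Qed.

Lemma lker_gen_comb (x : I -> R) : (forall j, 0 < x j) ->
  lker (mxop (cplx_mx (gen_comb x))) = cone_ker.
Proof.
move=> x0; rewrite cplx_gen_comb; apply/vspaceP => v; apply/idP/idP.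
  move=> vl; have v0 := ker_gen_comb x0 (mulmx_lker_mxop vl).
  apply: memv_lker_mxop; rewrite /cone_sum /gen_comb mulmx_suml big1 // => j _.
  by rewrite -scalemxAl v0 scaler0.
by move=> vK; apply: memv_lker_mxop; exact: cone_ker_gen vK.
Qed.

Lemma conj_cplx_gen_comb (x : I -> R) :
  cj (cplx_mx (gen_comb x)) = cplx_mx (gen_comb x).
Proof.
rewrite cplx_gen_comb conj_gen_comb; congr gen_comb.
by apply/funext => j; rewrite conjC_real.
Qed.

Lemma cone_img_hperp : cone_img = hperp cone_ker.
Proof.
by rewrite /cone_img limg_hperp_lker // cone_sumE -cplx_gen_comb
   ?conj_cplx_gen_comb // cplx_gen_comb; apply: gen_comb_sp.
Qed.

Lemma limg_gen_comb (x : I -> R) : (forall j, 0 < x j) ->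
  limg (mxop (cplx_mx (gen_comb x))) = cone_img.
Proof.
move=> x0; rewrite limg_hperp_lker ?conj_cplx_gen_comb //.
  by rewrite lker_gen_comb // cone_img_hperp.
by rewrite cplx_gen_comb; apply: gen_comb_sp.
Qed.

(** Every complex combination is skew for Q and kills K, which is stable under conjugation; its
    image is therefore orthogonal to K, and M is the full orthogonal. *)
Lemma gen_comb_img v (c : I -> C) : gen_comb c *m v \in cone_img.
Proof.
rewrite cone_img_hperp; apply/memv_hperp => k kK.
have ckK : cj k \in cone_ker.
  have k0 := mulmx_lker_mxop kK; apply: memv_lker_mxop.
  by rewrite cone_sumE -cplx_gen_comb -conj_mulmx ?conj_cplx_gen_comb // cplx_gen_comb k0 map_mx0.
by rewrite (Qform_sp _ _ (gen_comb_sp c)) cone_ker_gen // Qform0r oppr0.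
Qed.

End GeneratorCombinations.

(** * The weight filtration of the cone *)

Section RelativeInterior.
Local Open Scope classical_set_scope.
Local Open Scope ring_scope.
Variables (R : realType) (n : nat) (sigma : nilpotent_cone n).
Local Notation I := 'I_(cone_size sigma).

(** Dependent generators do not determine their coefficients; the pseudo-inverse of the matrix of
    generators chooses them linearly, hence with a bound. *)
Lemma cone_span_bounded : exists2 e : R, 0 < e &
  forall N, cone_span R sigma N -> (forall a b, `|N a b| < e) ->
  exists2 y : I -> R, gen_comb y = N & forall j, `|y j| <= 1.
Proof.
pose G : 'M[R]_(cone_size sigma, (n + n) * (n + n)) := \matrix_j mxvec (gen_at R j).
have GE (y : I -> R) : mxvec (gen_comb y) = (\row_j y j) *m G.
  rewrite /gen_comb linear_sum mulmx_sum_row; apply: eq_bigr => j _ /=.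
  by rewrite linearZ /= rowK mxE.
pose S := \sum_k \sum_j `|pinvmx G k j|.
have S0 : 0 <= S by apply: sumr_ge0 => k _; apply: sumr_ge0.
exists (1 + S)^-1 => [|N [x _ <-] small]; first by rewrite invr_gt0 ltr_wpDr.
pose y := mxvec (gen_comb x) *m pinvmx G.
exists (y 0) => [|j].
  apply: (can_inj mxvecK); rewrite GE.
  have -> : \row_j y 0 j = y by apply/rowP => j; rewrite mxE.
  by rewrite /y mulmxKpV // GE submxMl.
rewrite /y mxE; apply: le_trans (ler_norm_sum _ _ _) _.
apply: (@le_trans _ _ (\sum_k (1 + S)^-1 * `|pinvmx G k j|)).
  apply: ler_sum => k _; rewrite normrM ler_wpM2r //.
  by case/mxvec_indexP: k => a b; rewrite mxvecE ltW.
rewrite -mulr_sumr mulrC ler_pdivrMr ?mul1r; last by rewrite ltr_wpDr.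
apply: (@le_trans _ _ S); last by rewrite lerDr.
by apply: ler_sum => k _; rewrite (bigD1 j) //= lerDl sumr_ge0.
Qed.

(** A small perturbation inside the span changes the coefficients 1 by at most 1, so they stay
    nonnegative. *)
Lemma cone_sum_relint : cone_relint R sigma (gen_comb (fun _ : I => 1)).
Proof.
split; first by exists (fun=> 1).
have [e e0 He] := cone_span_bounded.
rewrite /within /=; apply/nbhs_ballP; exists e => // N [_ Ne] [x _ xN].
have [|a b|y yE y1] := He (gen_comb (fun j => x j - 1)).
- by exists (fun j => x j - 1).
- have := Ne a b; rewrite /ball /= distrC.
  rewrite (gen_combD x (fun=> -1)) (gen_combN (fun=> 1)) xN mxE.
  by congr (`|_| < _); rewrite mxE.
exists (fun j => y j + 1) => [j|].
  by have := y1 j; rewrite ler_norml => /andP[? _]; lra.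
rewrite -xN gen_combD yE -gen_combD; congr gen_comb.
by apply/funext => j; rewrite subrK.
Qed.

(** Near an interior point one may subtract d times the sum of the generators and remain in the
    cone; adding it back makes every coefficient at least d. *)
Lemma cone_relintP N : cone_relint R sigma N ->
  exists2 x : I -> R, (forall j, 0 < x j) & N = gen_comb x.
Proof.
case=> [[x x0 ->]]; rewrite /within /= => /nbhs_ballP[e /= e0 He].
pose N1 : 'M[R]_(n + n) := gen_comb (fun _ : I => 1).
pose S := \sum_a \sum_b `|N1 a b|.
have S0 : 0 <= S by apply: sumr_ge0 => a _; apply: sumr_ge0.
have S1 : 0 < 1 + S by rewrite ltr_wpDr.
pose d := e / (1 + S).
have d0 : 0 < d by rewrite divr_gt0.
have [||y y0 yE] := He (gen_comb (fun j => x j - d)).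
- split=> // a b; rewrite /ball /= (gen_combD x (fun=> - d)).
  rewrite [X in `|_ - X|]mxE opprD addNKr normrN.
  have -> : gen_comb (fun _ : I => - d) = - d *: N1.
    by rewrite -gen_combZ; congr gen_comb; apply/funext => j; rewrite mulr1.
  rewrite mxE normrM normrN (gtr0_norm d0) /d mulrAC ltr_pdivrMr // ltr_pM2l //.
  apply: (@le_lt_trans _ _ S); last by rewrite ltrDr.
  by rewrite /S (bigD1 a) //= (bigD1 b) //= -addrA lerDl addr_ge0 // sumr_ge0 // => *;
     apply: sumr_ge0.
- by exists (fun j => x j - d).
exists (fun j => y j + d) => [j|]; first by rewrite ltr_wpDl.
rewrite gen_combD -yE -gen_combD; congr gen_comb.
by apply/funext => j; rewrite subrK.
Qed.

End RelativeInterior.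

Section WeightFiltration.
Local Open Scope classical_set_scope.
Local Open Scope ring_scope.
Variables (R : realType) (n : nat).
Local Notation C := R[i].
Local Notation V := 'cV[C]_(n + n).
Implicit Types (N : 'M[R]_(n + n)) (W : filtration R n).

Lemma mxop_imgP (X : 'M[C]_(n + n)) (U : {vspace V}) (v : V) :
  reflect (exists2 u, u \in U & v = X *m u) (v \in mxop X @: U)%VS.
Proof.
apply: (iffP memv_imgP) => -[u uU ->]; exists u => //; by rewrite lfunE.
Qed.

Lemma expmx_ge2 (X : 'M[C]_(n + n)) j : X ^+ 2 = 0 -> X ^+ j.+2 = 0.
Proof. by move=> X2; rewrite -addn2 exprD X2 mulr0. Qed.

(** As N^j = 0 for j >= 2, the injectivity clauses collapse W_{j+1} to W_j for j >= 0 and the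
    surjectivity clauses collapse everything from W_{-3} down; boundedness gives W_0 = H_C and
    W_{-3} = 0. The case j = 1 identifies W_{-1} and W_{-2}. *)
Lemma weight_filtration_unique N W : cplx_mx N ^+ 2 = 0 ->
  is_weight_filtration N W ->
  two_step_weight (limg (mxop (cplx_mx N))) (lker (mxop (cplx_mx N))) W.
Proof.
set X := cplx_mx N => X2 [mono [k0 [W0 Wf]] XW inj surj].
have monoD k (m : nat) : (W k <= W (k + m%:Z)%R)%VS.
  elim: m => [|m IH]; first by rewrite addr0.
  by apply: subv_trans IH _; have -> : k + m.+1%:Z = k + m%:Z + 1 by lia.
have monoL (k l : int) : k <= l -> (W k <= W l)%VS.
  by move=> kl; have -> : l = k + `|l - k|%N%:Z by lia.
have up (j : nat) : (W j.+1%:Z <= W j%:Z)%VS.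
  apply/subvP => v vW; have := inj j.+2 v; rewrite expmx_ge2 // mul0mx mem0v.
  have -> : -1 + j.+2%:Z = j.+1%:Z by lia.
  have -> : j.+1%:Z - 1 = j%:Z by lia.
  by apply.
have upf (m : nat) : (W m%:Z <= W 0%R)%VS.
  by elim: m => // m IH; apply: subv_trans (up m) IH.
have Wtop (k : int) : 0 <= k -> W k = fullv.
  move=> k0'; apply/eqP; rewrite eqEsubv subvf /=.
  apply: subv_trans (monoL 0 k k0').
  have : (fullv <= W `|k0|%N%:Z)%VS by rewrite -Wf; apply: monoL; lia.
  by move=> /subv_trans; apply.
have down (j : nat) : (W (- 3 - j%:Z)%R <= W (- 3 - j.+1%:Z)%R)%VS.
  have := surj j.+2; rewrite expmx_ge2 //.
  have -> : (mxop 0%R @: W (-1 + j.+2%:Z)%R)%VS = 0%VS.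
    by apply/eqP; rewrite -subv0; apply/subvP => _ /mxop_imgP[u _ ->]; rewrite mul0mx mem0v.
  have -> : -1 - j.+2%:Z - 1 = - 3 - j.+1%:Z by lia.
  have -> : -1 - j.+2%:Z = - 3 - j%:Z by lia. rewrite add0v. by [].
have downf (m : nat) : (W (- 3)%R <= W (- 3 - m%:Z)%R)%VS.
  elim: m => [|m IH]; first by rewrite subr0.
  exact: subv_trans IH (down m).
have Wbot (k : int) : k <= - 3 -> W k = 0%VS.
  move=> k3; apply/eqP; rewrite -subv0.
  apply: subv_trans (monoL _ _ k3) _; apply: subv_trans (downf `|k0|%N) _.
  by rewrite -W0; apply: monoL; lia.
split=> //.
- apply/eqP; rewrite eqEsubv; apply/andP; split; apply/subvP => v vW.
    apply: memv_lker_mxop; apply/eqP; rewrite -memv0 -(Wbot (-1 - 2)) //.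
    by apply: (subvP (XW (-1))); apply/mxop_imgP; exists v.
  have := inj 1%N v; rewrite expr1 (mulmx_lker_mxop vW) mem0v.
  by rewrite Wtop ?memvf //; apply.
apply/eqP; rewrite eqEsubv; apply/andP; split.
  have := surj 1%N; rewrite expr1 (Wtop (-1 + 1%:Z)) // (Wbot (-1 - 1%:Z - 1)) //.
  by rewrite addv0.
by have := XW 0; rewrite Wtop.
Qed.

Definition step_weight (M K : {vspace V}) : filtration R n := fun k =>
  if 0 <= k then fullv else if k == -1 then K else if k == -2 then M else 0%VS.

Lemma step_weightP M K : two_step_weight M K (step_weight M K).
Proof.
rewrite /step_weight; split=> [k ->|||k k3] //.
by case: ifP => [|_]; [lia | case: ifP => [|_]; [lia | case: ifP => // ]; lia].
Qed.

Lemma step_weight_filtration N : cplx_mx N ^+ 2 = 0 ->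
  is_weight_filtration N
    (step_weight (limg (mxop (cplx_mx N))) (lker (mxop (cplx_mx N)))).
Proof.
set X := cplx_mx N => X2; set M := limg _; set K := lker _; set W := step_weight M K.
have [Wtop W1 W2 Wbot] := step_weightP M K; rewrite -/W in Wtop W1 W2 Wbot.
have MK : (M <= K)%VS.
  apply/subvP => _ /mxop_imgP[v _ ->]; apply: memv_lker_mxop.
  by rewrite mulmxA -[X *m X]/(X ^+ 2) X2 mul0mx.
have cases (k : int) : [\/ 0 <= k, k = -1, k = -2 | k <= -3] by
  have [?|?] := lerP 0 k; [constructor 1 | have [?|?] := eqVneq k (-1);
   [constructor 2 | have [?|?] := eqVneq k (-2); [constructor 3 | constructor 4; lia]]].
split.
- move=> k; case: (cases k) => [k0|->|->|k3].
  + by rewrite !Wtop //; lia.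
  + by rewrite (Wtop (-1 + 1)) // subvf.
  + by rewrite W2 (W1 : W (-2 + 1) = K).
  + by rewrite Wbot // sub0v.
- by exists (-3); rewrite Wbot // Wtop.
- move=> k; case: (cases k) => [k0|->|->|k3].
  + rewrite Wtop //; have [k2|k2] := lerP 2 k; first by rewrite Wtop ?subvf //; lia.
    have [->|k1] := eqVneq k 1; first by rewrite (W1 : W (1 - 2) = K).
    by have -> : k = 0 by lia; rewrite (W2 : W (0 - 2) = M).
  + rewrite W1; apply/subvP => _ /mxop_imgP[v /mulmx_lker_mxop -> ->]; exact: mem0v.
  + rewrite W2; apply/subvP => _ /mxop_imgP[v /(subvP MK)/mulmx_lker_mxop -> ->]; exact: mem0v.
  + by rewrite Wbot // limg0 sub0v.
- case=> [|[|j]] v.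
  + by rewrite expr0 mul1mx => _ vW; exact: vW.
  + rewrite expr1 => _; rewrite (Wbot (-1 - 1%:Z - 1)) // memv0 => /eqP v0.
    by rewrite (W1 : W (-1 + 1%:Z - 1) = K); apply: memv_lker_mxop.
  + by move=> _ _; rewrite Wtop ?memvf //; lia.
- case=> [|[|j]].
  + rewrite expr0; apply: subv_trans (addvSl _ _); apply/subvP => v vK.
    by apply/mxop_imgP; exists v; [exact: vK | rewrite mul1mx].
  + rewrite expr1 (W2 : W (-1 - 1%:Z) = M) (Wtop (-1 + 1%:Z)) //; exact: addvSl.
  + by rewrite Wbot ?sub0v //; lia.
Qed.

End WeightFiltration.

Section ConeWeight.
Local Open Scope classical_set_scope.
Local Open Scope ring_scope.
Variables (R : realType) (n : nat) (sigma : nilpotent_cone n).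
Hypothesis sq0 : forall N : 'M[R]_(n + n), cone R sigma N -> N ^+ 2 = 0.
Hypothesis psd : forall j v, 0 <= nilp_form (gen_at (sigma := sigma) R[i] j) v v.

(** All interior elements share kernel and image, so [step_weight] is a common weight filtration and
    the choice in [cone_weight] is not the default. Uniqueness at the sum of the generators
    identifies it. *)
Lemma cone_weight_two_step :
  two_step_weight (cone_img R sigma) (cone_ker R sigma) (cone_weight R sigma).
Proof.
have pos1 (j : 'I_(cone_size sigma)) : 0 < (1 : R) by [].
have X2 (x : 'I_(cone_size sigma) -> R) : cplx_mx (gen_comb x) ^+ 2 = 0 :> 'M[R[i]]_(n + n).
  by rewrite cplx_gen_comb; exact: gen_comb_mul0 sq0 _ _.
have : forall N, cone_relint R sigma N -> is_weight_filtration N (cone_weight R sigma).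
  apply: (xgetPex (fun=> 0%VS : {vspace 'cV[R[i]]_(n + n)})
    (P := [set W : int -> {vspace 'cV[R[i]]_(n + n)} |
       forall N, cone_relint R sigma N -> is_weight_filtration N W])).
  exists (step_weight (cone_img R sigma) (cone_ker R sigma)) => N /cone_relintP[x x0 ->].
  have := step_weight_filtration (X2 x).
  by rewrite (lker_gen_comb psd x0) (limg_gen_comb psd x0).
move=> /(_ _ (cone_sum_relint R sigma)) /weight_filtration_unique.
rewrite (lker_gen_comb psd pos1) (limg_gen_comb psd pos1); apply.
exact: X2.
Qed.

End ConeWeight.

(** * Lifting a Siegel orbit *)

Lemma dim_limg_mxop (R : realType) (n : nat) (X : 'M[R[i]]_(n + n)) :
  (\dim (limg (mxop X)) <= \rank X)%N.
Proof.
have sub : (limg (mxop X) <= limg (linfun (mulmx (col_base X))))%VS.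
  apply/subvP => _ /memv_imgP[v _ ->]; apply/memv_imgP.
  by exists (row_base X *m v)%R; rewrite ?memvf // !lfunE /= mulmxA mulmx_base.
apply: leq_trans (dimvS sub) _.
pose f : 'Hom('cV[R[i]]_(\rank X), 'cV[R[i]]_(n + n)) := linfun (mulmx (col_base X)).
apply: (leq_trans (leq_addl (\dim (fullv :&: lker f)) _)).
by rewrite limg_ker_dim dim_cVf.
Qed.

Section SiegelFiltrations.
Local Open Scope classical_set_scope.
Local Open Scope ring_scope.
Variables (R : realType) (n : nat).

Lemma siegel_tail (p : int) : tail_sum (siegel_numbers n) p =
  if p <= -1 then (n + n)%N else if p == 0 then n else 0%N.
Proof.
have fin : finite_set [set p : int | siegel_numbers n p <> 0%N].
  apply: sub_finite_set (finite_int_interval 1) => s /=.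
  rewrite /siegel_numbers; case: ifP => // /orP[] /eqP ->; by [].
have high q : 1 <= q -> tail_sum (siegel_numbers n) q = 0%N.
  move=> q1; apply: fsbig1 => s /= qs; rewrite /siegel_numbers.
  by have -> : (s == 0) || (s == -1) = false by lia.
have t0 : tail_sum (siegel_numbers n) 0 = n.
  by rewrite (tail_sum_step 0 fin) high // addn0.
have low (k : nat) : tail_sum (siegel_numbers n) (- 1 - k%:Z) = (n + n)%N.
  elim: k => [|k IH]; first by rewrite subr0 (tail_sum_step _ fin) addNr t0.
  rewrite (tail_sum_step _ fin); have -> : -1 - k.+1%:Z + 1 = - 1 - k%:Z by lia.
  rewrite IH /siegel_numbers.
  by have -> : (-1 - k.+1%:Z == 0) || (-1 - k.+1%:Z == -1) = false by lia.
case: ifP => p1; last by case: eqVneq => [->|p0] //; apply: high; lia.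
by have -> : p = - 1 - (`|p| - 1)%N%:Z by lia.
Qed.

Variable F : filtration R n.
Hypothesis dualF : compact_dual R (siegel_numbers n) F.

Lemma siegel_filtrationE p :
  F p = if p <= -1 then fullv else if p == 0 then F 0 else 0%VS.
Proof.
have [_ dimF _] := dualF.
have := dimF p; rewrite -/(tail_sum _ p) siegel_tail.
case: ifP => p1 dimp.
  by apply/eqP; rewrite eqEdim subvf dimp dimvf /dim /= muln1 leqnn.
case: eqVneq dimp => [->|p0] // dimp.
by apply/eqP; rewrite -dimv_eq0 dimp.
Qed.

Lemma siegel_dim0 : \dim (F 0) = n.
Proof. by have [_ dimF _] := dualF; rewrite dimF -/(tail_sum _ 0) siegel_tail. Qed.

Lemma siegel_isotropic v w : v \in F 0 -> w \in F 0 -> Qform v w = 0.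
Proof. by have [_ _ iso] := dualF; move=> vF wF; apply: (iso 0); rewrite ?oppr0. Qed.

End SiegelFiltrations.

Lemma siegel_domain_full (R : realType) (n : nat) (F : filtration R n) :
  period_domain R (siegel_numbers n) F -> (F 0%R + conj_vspace (F 0%R))%VS = fullv.
Proof. by case=> _ /(_ 0%R)[+ _] _; rewrite oppr0. Qed.

Lemma siegel_domain_pos (R : realType) (n : nat) (F : filtration R n) v :
  period_domain R (siegel_numbers n) F -> v \in F 0%R -> v != 0%R ->
  (0 < hnorm v)%R.
Proof.
move=> [dualF _ pos] vF vN0; have := pos 0%R (-1)%R v erefl.
rewrite sub0r opprK expr1z; apply => //.
by rewrite memv_cap vF (siegel_filtrationE dualF) /= conj_vspacef memvf.
Qed.

Section Surjectivity.
#[local] Opaque gen_comb nilexp.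
Local Open Scope classical_set_scope.
Local Open Scope ring_scope.
Variables (R : realType) (n : nat) (sigma : nilpotent_cone n).
Local Notation C := R[i].
Local Notation V := 'cV[C]_(n + n).
Local Notation I := 'I_(cone_size sigma).
Local Notation cj := (map_mx Num.conj).
Hypothesis sq0 : forall N : 'M[R]_(n + n), cone R sigma N -> N ^+ 2 = 0.
Variable F' : filtration R n.
Hypothesis orbF' : generates_orbit (siegel_numbers n) sigma F'.
Let L : {vspace V} := F' 0.
Let M := cone_img R sigma.
Let K := cone_ker R sigma.
Let T (c : I -> C) : 'End(V) := mxop (1%:M + gen_comb c).

Lemma act_nilexpE (c : I -> C) (G : filtration R n) p :
  act_filtration (nilexp (gen_comb c)) G p = (T c @: G p)%VS.
Proof. by rewrite /act_filtration (nilexp_gen_comb sq0). Qed.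

Let dualF' : compact_dual R (siegel_numbers n) F'. Proof. by case: orbF'. Qed.
Let isoL v w : v \in L -> w \in L -> Qform v w = 0.
Proof. exact: siegel_isotropic dualF' v w. Qed.
Let dimL : \dim L = n. Proof. exact: siegel_dim0 dualF'. Qed.

Let imag (x : I -> R) (j : I) : C := 'i%C * (x j)%:C%C.

Let imagE (x : I -> R) : 'i%C *: cplx_mx (gen_comb x) = gen_comb (imag x) :> 'M[C]_(n + n).
Proof. by rewrite cplx_gen_comb -gen_combZ. Qed.

Lemma siegel_bound : exists b : R, 0 <= b /\
  forall x : I -> R, (forall j, b < x j) ->
  (T (imag x) @: L + conj_vspace (T (imag x) @: L))%VS = fullv /\
  (forall v, v \in (T (imag x) @: L)%VS -> v != 0 -> 0 < hnorm v).
Proof.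
(* A nonnegative bound is preserved when x is scaled by t >= 1. *)
have [_ [b Hb] _] := orbF'; exists (Num.max b 0); split; first by rewrite le_max lexx orbT.
move=> x xb; have xb' j : b < x j by move: (xb j); rewrite gt_max => /andP[].
have := Hb x xb'.
rewrite imagE => dom; rewrite -!act_nilexpE; split; first exact: siegel_domain_full dom.
by move=> v; exact: siegel_domain_pos dom.
Qed.

Let TE (c : I -> C) v : T c v = v + gen_comb c *m v.
Proof. by rewrite lfunE /= mulmxDl mul1mx. Qed.

(** The Siegel condition controls N_x for large x only. Scaling x by t >= 1 makes N_x semidefinite
    by [nilp_form_ge0]; adding t to the j-th coordinate then exhibits the form of N_j as a slope. *)
Lemma gen_psd (j : I) v : 0 <= nilp_form (gen_at C j) v v.
Proof.
have [b [b0 Hb]] := siegel_bound.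
have psdx (x : I -> R) : (forall k, b < x k) -> 0 <= nilp_form (cplx_mx (gen_comb x)) v v.
  move=> xb; apply: (nilp_form_ge0 _ _ _ isoL dimL).
  - exact: conj_cplx_gen_comb.
  - by rewrite cplx_gen_comb; exact: gen_comb_sp.
  - by rewrite cplx_gen_comb; exact: gen_comb_mul0.
  move=> t u t1 uL.
  have xtb k : b < t * x k.
    by apply: lt_le_trans (xb k) _; rewrite ler_peMl // ltW // (le_lt_trans b0).
  have -> : u + ('i%C * t%:C%C) *: (cplx_mx (gen_comb x) *m u) =
            T (imag (fun k => t * x k)) u.
    rewrite TE -imagE cplx_gen_comb cplx_gen_comb -scalemxAl scalemxAl.
    rewrite scalemxAl -scalerA; congr (_ + _ *: _ *m _).
    by rewrite -gen_combZ; congr gen_comb; apply/funext => k; rewrite rmorphM.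
  by have [_ pos] := Hb _ xtb; apply: pos; exact: memv_img.
pose N1 : 'M[C]_(n + n) := gen_comb (fun _ : I => (b + 1)%:C%C).
apply: (@ge0_slope _ (nilp_form N1 v v)) => t t1.
have := psdx (fun k => b + 1 + t * (k == j)%:R) _.
have -> : nilp_form (cplx_mx (gen_comb (fun k => b + 1 + t * (k == j)%:R))) v v =
  nilp_form N1 v v + t%:C%C * nilp_form (gen_at C j) v v.
  rewrite gen_combD gen_combZ gen_comb_delta /cplx_mx map_mxD map_mxZ.
  rewrite -/(cplx_mx (gen_comb (fun=> b + 1))) cplx_gen_comb -/N1.
  have -> : map_mx (real_complex R) (gen_at R j) = gen_at C j.
    by apply/matrixP => r s; rewrite !mxE fmorph_rat.
  by rewrite /nilp_form mulmxDl -scalemxAl QformDl QformZl opprD mulrN.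
apply => k; apply: (@lt_le_trans _ _ (b + 1)); first by rewrite ltrDl.
by rewrite lerDl mulr_ge0 ?ler0n // (le_trans ler01).
Qed.

(** A vector of L in K is fixed by every exp(i N_x), so it lies in a point of Siegel space and
    inherits its positivity. *)
Lemma cone_limit_lagrangian : limit_lagrangian M K L.
Proof.
have [b [b0 Hb]] := siegel_bound.
have sumE : cone_sum R sigma = cplx_mx (gen_comb (fun _ : I => 1)) by rewrite cplx_gen_comb.
apply: limit_lagrangian_nilp isoL dimL _; rewrite ?sumE.
- exact: conj_cplx_gen_comb.
- by rewrite cplx_gen_comb; exact: gen_comb_sp.
- by rewrite cplx_gen_comb; exact: gen_comb_mul0.
rewrite -sumE => v vL v0 vN0.
have vK : v \in K by apply: memv_lker_mxop.
have [|_ pos] := Hb (fun=> b + 1); first by move=> j; rewrite ltrDl.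
apply: pos => //; apply/memv_imgP; exists v => //.
by rewrite TE (cone_ker_gen gen_psd) // addr0.
Qed.

Let LL := cone_limit_lagrangian.
Let genM (c : I -> C) v : gen_comb c *m v \in M.
Proof. exact: gen_comb_img gen_psd _ _. Qed.
Let genK (c : I -> C) v : v \in K -> gen_comb c *m v = 0.
Proof. exact: cone_ker_gen gen_psd _ _. Qed.

Lemma cone_limit_lagrangian_shift (c : I -> C) : limit_lagrangian M K (T c @: L).
Proof. exact: limit_lagrangian_shift LL (gen_comb_sp c) (genM c) (genK c). Qed.

Section Lift.
Variables (h : int -> nat) (alpha : int -> nat).
Hypothesis prof : even_profile n h (\dim M) alpha.
Let F := hfil M K L alpha.

Lemma act_hfil (c : I -> C) :
  act_filtration (nilexp (gen_comb c)) F = hfil M K (T c @: L) alpha.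
Proof.
apply/funext => p; rewrite act_nilexpE; apply/esym.
exact: hfil_shift LL (genM c) (genK c) p.
Qed.

Lemma hfil_generates_orbit : generates_orbit h sigma F.
Proof.
split; first exact: compact_dual_hfil LL prof.
  have [b [_ Hb]] := siegel_bound; exists b => x xb; have [full pos] := Hb x xb.
  rewrite imagE act_hfil.
  exact: period_domain_hfil (cone_limit_lagrangian_shift _) prof full pos.
move=> N [x _ ->] p; rewrite cplx_gen_comb.
have H := hfil_transverse alpha LL p (genM (fun j => (x j)%:C%C)) (genK (fun j => (x j)%:C%C)).
exact: H.
Qed.

(** A translate of F is the lift of the translated Lagrangian, with the same weight filtration, so
    its even part is computed in the same way as that of F. *)
Lemma even_filtration_hfil (c : I -> C) :
  even_filtration sigma (act_filtration (nilexp (gen_comb c)) F) =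
  act_filtration (nilexp (gen_comb c)) F'.
Proof.
apply/funext => p; rewrite act_nilexpE (siegel_filtrationE dualF') /even_filtration.
case: ifP => p1.
  apply/eqP; rewrite eq_sym eqEdim subvf.
  by rewrite (dim_shift LL (genM c) (genK c)) leqnn.
case: ifP => p0; last by rewrite limg0.
rewrite act_hfil.
have evenT := even_part_hfil (cone_limit_lagrangian_shift c) prof
  (cone_weight_two_step sq0 gen_psd).
exact evenT.
Qed.

Lemma act_nilexpD (c d : I -> C) (G : filtration R n) :
  act_filtration (nilexp (gen_comb c)) (act_filtration (nilexp (gen_comb d)) G) =
  act_filtration (nilexp (gen_comb (fun j => c j + d j))) G.
Proof.
have TT : (T c \o T d)%VF = T (fun j => c j + d j).
  apply/lfunP => v; rewrite comp_lfunE (TE d v) (TE c (v + _)) (TE _ v).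
  rewrite mulmxDr mulmxA (gen_comb_mul0 sq0) mul0mx addr0.
  by rewrite gen_combD mulmxDl addrA addrAC.
apply/funext => p; transitivity (T c @: (T d @: G p))%VS.
  exact: etrans (act_nilexpE c _ p) (congr1 _ (act_nilexpE d G p)).
by rewrite -limg_comp TT; exact: esym (act_nilexpE _ G p).
Qed.

Lemma p_ev_hfil : p_ev sigma (exp_orbit sigma F) = exp_orbit sigma F'.
Proof.
apply/seteqP; split=> G.
  move=> [_ [_ [c _ <-] <-]] [_ [d _ <-] <-].
  rewrite even_filtration_hfil act_nilexpD.
  by exists (gen_comb (fun j => d j + c j)) => //; exists (fun j => d j + c j).
move=> [_ [d _ <-] <-].
(* F itself, written as its translate by exp(0) to match [even_filtration_hfil]. *)
exists (act_filtration (nilexp (gen_comb (fun _ : I => 0))) F).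
  by exists (gen_comb (fun _ : I => 0)) => //; exists (fun=> 0).
rewrite even_filtration_hfil.
exists (gen_comb d); first by exists d.
have d0 : (fun j => d j + 0) = d by apply/funext => j; rewrite addr0.
by rewrite act_nilexpD d0.
Qed.

End Lift.
End Surjectivity.

Theorem proposition2p5 (R : realType) (n : nat) (h : int -> nat)
    (hnum : hodge_numbers n h) (sigma : nilpotent_cone n)
    (hev : even_type_cone R h sigma)
    (hrank : forall N : 'M[R]_(n + n), cone_relint R sigma N ->
       (\rank N <= h 0%R)%N) :
  set_surj (nilpotent_orbits R h sigma)
    (nilpotent_orbits R (siegel_numbers n) sigma) (@p_ev R n sigma).
Proof.
have [[F0 orbF0] even] := hev; have [sq0 _] := even F0 orbF0.
move=> _ [F' orbF' <-].
(* M is the image of the complexified sum of the generators, an interior point of the cone, so its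
   dimension is at most a rank bounded by [hrank]. *)
have dimM : (\dim (cone_img R sigma) <= h 0%R)%N.
  apply: leq_trans (hrank _ (cone_sum_relint R sigma)).
  apply: leq_trans (dim_limg_mxop _) _.
  rewrite -(mxrank_map (real_complex R)) -/(cplx_mx _) cplx_gen_comb.
  exact: leqnn.
have [alpha prof] := even_profile_exists hnum dimM.
pose F := hfil (cone_img R sigma) (cone_ker R sigma) (F' 0%R) alpha.
have orbF : generates_orbit h sigma F := hfil_generates_orbit sq0 orbF' prof.
exists (exp_orbit sigma F); first by exists F.
have evF := p_ev_hfil sq0 orbF' prof.
exact evF.
Qed.
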